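(* Let $f, g \in \mathbb{Z}[t,t^{-1}]$ be two Laurent polynomials and let $\mu \in \widehat{\mathbb{Z}}^\times$. Assume that $(f(t)) = (g(t^\mu))$ is an equality of continuous ideals in $\widehat{\mathbb{Z}}[[\widehat{\mathbb{Z}}]]$. Moreover, assume that either $f$ or $g$ has a root that is not a root of unity. Then $\mu = \pm 1$, and $f(t) = g(t^{\pm 1})$ (with the same sign) up to a unit of $\mathbb{Z}[t,t^{-1}]$.
   Context: A root of a Laurent polynomial $f$ in a field $K$ is a non-zero $\alpha\in K$ with $f(\alpha)=0$; here roots are taken in an algebraic closure of $\mathbb{Q}$. $\widehat{\mathbb{Z}}$ is the profinite completion of $\mathbb{Z}$, and $\widehat{\mathbb{Z}}[[\widehat{\mathbb{Z}}]] = \varprojlim_{m,n} (\mathbb{Z}/m)[\mathbb{Z}/n]$ is the completed group ring of the (additive) profinite group $\widehat{\mathbb{Z}}$ with coefficients in $\widehat{\mathbb{Z}}$. The group ring $\mathbb{Z}[\mathbb{Z}] \simeq \mathbb{Z}[t,t^{-1}]$ embeds in it, with $t$ corresponding to the group element $1\in\mathbb{Z}\subset\widehat{\mathbb{Z}}$; for $\nu\in\widehat{\mathbb{Z}}$, $t^\nu$ denotes the group element $\nu\in\widehat{\mathbb{Z}}$. For $g=\sum_k a_k t^k$, $g(t^\mu) = \sum_k a_k t^{k\mu}$. For an element $x$, $(x)$ denotes the principal ideal of $\widehat{\mathbb{Z}}[[\widehat{\mathbb{Z}}]]$ generated by $x$ (automatically closed, by compactness; called a continuous ideal).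
   Formalization: The Laurent polynomials f and g are assumed not both zero; for f = g = 0 the ideals agree and every non-zero algebraic number is a root, so the claim fails for any unit μ other than ±1. *)

(* Defs.v *)
From HB Require Import structures.
From mathcomp Require Import all_boot all_order all_algebra all_field finmap.
From mathcomp Require Import monalg boolp classical_sets.

Set Implicit Arguments.
Unset Strict Implicit.
Unset Printing Implicit Defensive.

Import Order.TTheory GRing.Theory Num.Theory.
Local Open Scope fset_scope.
Local Open Scope ring_scope.

Definition is_unit (R : comPzRingType) (x : R) : Prop := exists y : R, x * y = 1.

Definition principal_ideal (R : comPzRingType) (x : R) : set R :=
  [set y | exists r : R, y = r * x]%classic.

(* The group ring R[K] of an additive abelian group K: finitely supported
   functions K -> R with the convolution product. The ring structure that monalg
   puts on {malg R[K]} needs a conical monoid of exponents, hence the alias.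
   grpterm a k is a times the group element k, g@_k the coefficient of g at k. *)
Definition grpring (R : comNzRingType) (K : zmodType) : Type := {malg R[K]}.

HB.instance Definition _ R K := GRing.Zmodule.copy (grpring R K) {malg R[K]}.

Definition grpterm (R : comNzRingType) (K : zmodType) (a : R) (k : K) :
  grpring R K := << a *g k >>.

Section GroupRing.
Variables (R : comNzRingType) (K : zmodType).
Implicit Types g : grpring R K.

Lemma grpterm0 (k : K) : grpterm (0 : R) k = 0.
Proof. exact: monalgU0. Qed.

Lemma grptermD (k : K) (a b : R) : grpterm (a + b) k = grpterm a k + grpterm b k.
Proof. exact: monalgUD. Qed.

Definition grpmul g1 g2 : grpring R K :=
  \sum_(k1 <- msupp g1) \sum_(k2 <- msupp g2) grpterm (g1@_k1 * g2@_k2) (k1 + k2)%R.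

Lemma grpmulw (d1 d2 : {fset K}) g1 g2 :
  msupp g1 `<=` d1 -> msupp g2 `<=` d2 ->
  grpmul g1 g2 =
    \sum_(k1 <- d1) \sum_(k2 <- d2) grpterm (g1@_k1 * g2@_k2) (k1 + k2)%R.
Proof.
move=> le_d1 le_d2; rewrite /grpmul (big_fset_incl _ le_d1) /=.
  apply/eq_bigr=> k1 _; apply/big_fset_incl => // k _ /mcoeff_outdom ->.
  by rewrite mulr0 grpterm0.
move=> k _ /mcoeff_outdom g1k.
by rewrite big1 => // k' _; rewrite g1k mul0r grpterm0.
Qed.

Lemma grpmulUU (c1 c2 : R) (k1 k2 : K) :
  grpmul (grpterm c1 k1) (grpterm c2 k2) = grpterm (c1 * c2) (k1 + k2)%R.
Proof. by rewrite (grpmulw msuppU_le msuppU_le) !big_seq_fset1 !mcoeffUU. Qed.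

Lemma grpmulC : commutative grpmul.
Proof.
move=> g1 g2; rewrite /grpmul exchange_big; apply: eq_bigr => k2 _.
by apply: eq_bigr => k1 _; rewrite mulrC [(k1 + k2)%R]addrC.
Qed.

Lemma grpmulDl : left_distributive grpmul +%R.
Proof.
move=> g1 g2 g.
rewrite [in RHS](grpmulw (fsubsetUl _ (msupp g2)) (fsubset_refl _)).
rewrite [in RHS](grpmulw (fsubsetUr (msupp g1) _) (fsubset_refl _)).
rewrite (grpmulw (msuppD_le _ _) (fsubset_refl _)).
rewrite -big_split /=; apply/eq_bigr=> k1 _.
rewrite -big_split /=; apply/eq_bigr=> k2 _.
by rewrite mcoeffD mulrDl grptermD.
Qed.

Lemma grpmulDr : right_distributive grpmul +%R.
Proof. by move=> g g1 g2; rewrite ![grpmul g _]grpmulC grpmulDl. Qed.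

Lemma grpmul0 g : grpmul 0 g = 0.
Proof. by rewrite /grpmul msupp0 big_seq_fset0. Qed.

Lemma grpmulr0 g : grpmul g 0 = 0.
Proof. by rewrite grpmulC grpmul0. Qed.

Lemma grpmul_suml (d : {fset K}) (F : K -> grpring R K) g :
  grpmul (\sum_(i <- d) F i) g = \sum_(i <- d) grpmul (F i) g.
Proof. exact: (big_morph (grpmul^~ g) (fun x y => grpmulDl x y g) (grpmul0 g)). Qed.

Lemma grpmul_sumr (d : {fset K}) (F : K -> grpring R K) g :
  grpmul g (\sum_(i <- d) F i) = \sum_(i <- d) grpmul g (F i).
Proof. exact: (big_morph (grpmul g) (grpmulDr g) (grpmulr0 g)). Qed.

Lemma grpringE g : g = \sum_(k <- msupp g) grpterm g@_k k.
Proof. exact: monalgE. Qed.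

Lemma grpmulA : associative grpmul.
Proof.
have A1 a1 k1 a2 k2 g : grpmul (grpterm a1 k1) (grpmul (grpterm a2 k2) g)
    = grpmul (grpmul (grpterm a1 k1) (grpterm a2 k2)) g.
  rewrite (grpringE g) !(grpmul_sumr (msupp g)); apply: eq_bigr => k3 _.
  by rewrite !grpmulUU mulrA addrA.
have A2 a1 k1 g2 g3 : grpmul (grpterm a1 k1) (grpmul g2 g3)
    = grpmul (grpmul (grpterm a1 k1) g2) g3.
  rewrite (grpringE g2) (grpmul_suml (msupp g2)) !(grpmul_sumr (msupp g2)).
  by rewrite (grpmul_suml (msupp g2)); apply: eq_bigr => k2 _; apply: A1.
move=> g1 g2 g3; rewrite (grpringE g1) !(grpmul_suml (msupp g1)).
by apply: eq_bigr => k1 _; apply: A2.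
Qed.

Lemma grpmul1 : left_id (grpterm 1 0) grpmul.
Proof.
move=> g; rewrite [in LHS](grpringE g) [in RHS](grpringE g) (grpmul_sumr (msupp g)).
by apply: eq_bigr => k _; rewrite grpmulUU mul1r add0r.
Qed.

Lemma grpone_neq0 : grpterm 1 (0 : K) != 0 :> grpring R K.
Proof. by rewrite monalgU_eq0 oner_eq0. Qed.

HB.instance Definition _ := GRing.Zmodule_isComNzRing.Build (grpring R K)
  grpmulA grpmulC grpmul1 grpmulDl grpone_neq0.

End GroupRing.

Section GroupRingMap.
Variables (R S : comNzRingType) (K L : zmodType).
Variables (f : {rmorphism R -> S}) (h : {additive K -> L}).

Definition grpmap (g : grpring R K) : grpring S L :=
  \sum_(k <- msupp g) grpterm (f g@_k) (h k).

Lemma grpmapw (d : {fset K}) (g : grpring R K) : msupp g `<=` d ->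
  grpmap g = \sum_(k <- d) grpterm (f g@_k) (h k).
Proof.
move=> le_d; rewrite /grpmap; apply/big_fset_incl => // k _ /mcoeff_outdom ->.
by rewrite rmorph0 grpterm0.
Qed.

Lemma grpmapU (c : R) (k : K) : grpmap (grpterm c k) = grpterm (f c) (h k).
Proof. by rewrite (grpmapw msuppU_le) big_seq_fset1 mcoeffUU. Qed.

Lemma grpmapB : {morph grpmap : x y / x - y}.
Proof.
move=> x y; rewrite (grpmapw (msuppB_le x y)) (grpmapw (fsubsetUl _ (msupp y))).
rewrite (grpmapw (fsubsetUr (msupp x) _)) -sumrB; apply: eq_bigr => k _.
rewrite mcoeffB rmorphB; exact: monalgUB.
Qed.

HB.instance Definition _ :=
  GRing.isZmodMorphism.Build (grpring R K) (grpring S L) grpmap grpmapB.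

Lemma grpmap_monoid : monoid_morphism grpmap.
Proof.
split=> [|x y]; first by rewrite grpmapU rmorph1 raddf0.
have UU a k b l : grpmap (grpmul (grpterm a k) (grpterm b l))
    = grpmul (grpmap (grpterm a k)) (grpmap (grpterm b l)).
  by rewrite grpmulUU !grpmapU grpmulUU rmorphM raddfD.
rewrite (grpringE x) mulr_suml !raddf_sum mulr_suml; apply: eq_bigr => k1 _.
rewrite (grpringE y) mulr_sumr !raddf_sum mulr_sumr; apply: eq_bigr => k2 _.
exact: UU.
Qed.

HB.instance Definition _ :=
  GRing.isMonoidMorphism.Build (grpring R K) (grpring S L) grpmap grpmap_monoid.

End GroupRingMap.

Section InverseLimit.
Variables (I : Type) (le : rel I) (R : I -> comNzRingType).
Variable phi : forall i j, le i j -> {rmorphism R j -> R i}.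

Record invlim : Type := InvLim {
  invproj : forall i, R i;
  invprojP : forall i j (le_ij : le i j), phi le_ij (invproj j) = invproj i
}.

Lemma invlimP (x y : invlim) : (forall i, invproj x i = invproj y i) -> x = y.
Proof.
case: x y => [x xP] [y yP] /= eq_xy.
have {}eq_xy : x = y by apply: functional_extensionality_dep.
by subst y; congr InvLim; apply: Prop_irrelevance.
Qed.

HB.instance Definition _ := gen_eqMixin invlim.
HB.instance Definition _ := gen_choiceMixin invlim.

Program Definition invlim_zero := @InvLim (fun i => 0) _.
Next Obligation. by move=> *; rewrite rmorph0. Qed.
Program Definition invlim_one := @InvLim (fun i => 1) _.
Next Obligation. by move=> *; rewrite rmorph1. Qed.
Program Definition invlim_opp x := @InvLim (fun i => - invproj x i) _.
Next Obligation. by move=> *; rewrite rmorphN invprojP. Qed.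
Program Definition invlim_add x y :=
  @InvLim (fun i => invproj x i + invproj y i) _.
Next Obligation. by move=> *; rewrite rmorphD !invprojP. Qed.
Program Definition invlim_mul x y :=
  @InvLim (fun i => invproj x i * invproj y i) _.
Next Obligation. by move=> *; rewrite rmorphM !invprojP. Qed.

Lemma invlim_addA : associative invlim_add.
Proof. by move=> x y z; apply: invlimP => i /=; rewrite addrA. Qed.
Lemma invlim_addC : commutative invlim_add.
Proof. by move=> x y; apply: invlimP => i /=; rewrite addrC. Qed.
Lemma invlim_add0 : left_id invlim_zero invlim_add.
Proof. by move=> x; apply: invlimP => i /=; rewrite add0r. Qed.
Lemma invlim_addN : left_inverse invlim_zero invlim_opp invlim_add.
Proof. by move=> x; apply: invlimP => i /=; rewrite addNr. Qed.
Lemma invlim_mulA : associative invlim_mul.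
Proof. by move=> x y z; apply: invlimP => i /=; rewrite mulrA. Qed.
Lemma invlim_mulC : commutative invlim_mul.
Proof. by move=> x y; apply: invlimP => i /=; rewrite mulrC. Qed.
Lemma invlim_mul1 : left_id invlim_one invlim_mul.
Proof. by move=> x; apply: invlimP => i /=; rewrite mul1r. Qed.
Lemma invlim_mulDl : left_distributive invlim_mul invlim_add.
Proof. by move=> x y z; apply: invlimP => i /=; rewrite mulrDl. Qed.

HB.instance Definition _ := GRing.isZmodule.Build invlim
  invlim_addA invlim_addC invlim_add0 invlim_addN.
HB.instance Definition _ := GRing.Zmodule_isComPzRing.Build invlim
  invlim_mulA invlim_mulC invlim_mul1 invlim_mulDl.

End InverseLimit.

(* All inverse systems below are indexed by moduli n + 2, n : nat, ordered by
   divisibility: the moduli >= 2 are cofinal among the positive ones, and they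
   are those for which 'Z_ is the ring of integers modulo the given modulus. *)
Definition dvd2 : rel nat := fun m n => (m.+2 %| n.+2)%N.

Definition Zred (m n : nat) (le_mn : dvd2 m n) (x : 'Z_(n.+2)) : 'Z_(m.+2) := inZp x.

Section ReductionMap.
Variables (m n : nat) (le_mn : dvd2 m n).
Local Notation Zred := (Zred le_mn).

Lemma Zred_zmod : zmod_morphism Zred.
Proof.
have inD (x y : 'Z_(n.+2)) : Zred (x + y) = Zred x + Zred y.
  by apply: val_inj; rewrite /= modn_dvdm // modnDm.
by move=> x y; apply: (addIr (Zred y)); rewrite -inD !subrK.
Qed.

Lemma Zred_monoid : monoid_morphism Zred.
Proof.
split=> [|x y]; apply: val_inj => //=.
by rewrite modn_dvdm // modnMm.
Qed.

HB.instance Definition _ :=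
  GRing.isZmodMorphism.Build 'Z_(n.+2) 'Z_(m.+2) Zred Zred_zmod.
HB.instance Definition _ :=
  GRing.isMonoidMorphism.Build 'Z_(n.+2) 'Z_(m.+2) Zred Zred_monoid.

End ReductionMap.

Definition Zhat : comPzRingType :=
  invlim (fun (m n : nat) (h : dvd2 m n) => (Zred h : {rmorphism _ -> _})).

Definition dvd22 : rel (nat * nat) :=
  fun i j => dvd2 i.1 j.1 && dvd2 i.2 j.2.

Definition ZZmod (i : nat * nat) : comNzRingType := grpring 'Z_(i.1.+2) 'Z_(i.2.+2).

Definition ZZred (i j : nat * nat) (h : dvd22 i j) : {rmorphism ZZmod j -> ZZmod i} :=
  grpmap (Zred (proj1 (andP h))) (Zred (proj2 (andP h))).

Definition ZhatZhat : comPzRingType := invlim ZZred.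

Fact tpow_subproof (nu : Zhat) (i j : nat * nat) (h : dvd22 i j) :
  ZZred h (grpterm 1 (invproj nu j.2)) = grpterm 1 (invproj nu i.2).
Proof.
rewrite /ZZred /= grpmapU rmorph1; congr grpterm.
exact: (invprojP nu (proj2 (andP h))).
Qed.

(* t^nu, the element nu of Zhat seen in the completed group ring *)
Definition tpow (nu : Zhat) : ZhatZhat :=
  @InvLim _ _ _ ZZred (fun i => grpterm 1 (invproj nu i.2)) (tpow_subproof nu).

(* Z[t, t^-1] = Z[Z] *)
Definition laurent : comNzRingType := grpring int int.

(* g(t^mu) *)
Definition laurent_subst (g : laurent) (mu : Zhat) : ZhatZhat :=
  \sum_(k <- msupp g) tpow (mu *~ k) *~ g@_k.

Definition laurent_embed (f : laurent) : ZhatZhat := laurent_subst f 1.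

(* g(t^-1) *)
Definition laurent_inv (g : laurent) : laurent :=
  \sum_(k <- msupp g) grpterm g@_k (- k).

Definition laurent_eval (f : laurent) (a : algC) : algC :=
  \sum_(k <- msupp f) (f@_k)%:~R * a ^ k.

Definition laurent_root (f : laurent) (a : algC) : Prop :=
  a != 0 /\ laurent_eval f a = 0.

Definition is_root_of_unity (a : algC) : Prop :=
  exists2 n : nat, (0 < n)%N & n.-unity_root a.

Definition eq_up_to_unit (f g : laurent) : Prop :=
  exists2 u : laurent, is_unit u & f = u * g.

(* Main.v *)
Require Import Defs.
From mathcomp Require Import all_boot all_order all_algebra all_field finmap.
From mathcomp Require Import monalg boolp.
From mathcomp Require Import zify ring.

Set Implicit Arguments.
Unset Strict Implicit.
Unset Printing Implicit Defensive.

Import Order.TTheory GRing.Theory Num.Theory.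
Local Open Scope ring_scope.

(* Let a be a root of f that is not a root of unity. Modulo (m, t^n - 1) the
   hypothesis says that g(t^k) lies in (f), where k = mu mod n. Linear algebra
   gives, for each c > 0, a nonzero integer polynomial Q of degree at most deg g
   with g(t) | Q(t^c); hence if c k = b mod n, then H = Q(t^b) lies in
   (f, t^n - 1). By pigeonhole one can take c bounded by C and |b| < n / C, with
   C constant. Let p be the minimal polynomial of a over Z, with leading
   coefficient l and roots z. Then t^n - 1 "divides" H modulo p, and comparing
   the sizes of the two norms, the one of t^n - 1 being about the n-th power of
   the Mahler measure l prod max(1, |z|) > 1, forces H(a) = Q(a^b) = 0 for
   suitable n divisible by any given N. As a is not a root of unity, b is then
   bounded independently of n, so that finally c mu = b or c mu = - b in Zhat for
   fixed integers c and b, and mu = 1 or mu = - 1 because mu is a unit.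
   If a is a root of g instead, exchange f and g and replace mu by its inverse.
   Once mu = 1 or - 1, f = g(t^mu) up to a unit because a principal ideal of
   Z[t, t^-1] is closed for the topology defined by the ideals (m, t^n - 1): if q
   is a prime not dividing the extreme coefficients of f, then t has finite order
   modulo (f, q^i). *)

Local Notation ZtoC := (map_poly (intr : int -> algC)).

(** * Minimal polynomials and norms *)

(** On [{poly int}], [%|] is divisibility over the rationals. The primitive part is taken because
    Gauss's lemma then yields quotients with integer coefficients. *)
Lemma int_minpoly (a : algC) :
  exists p : {poly int}, [/\ p != 0, zcontents p = 1, 0 < lead_coef p, root (ZtoC p) a
     & forall q : {poly int}, root (ZtoC q) a = (p %| q)].
Proof.
have [q [Dq mon_q] qP] := minCpolyP a.
have [r [c nz_c Dr]] := rat_poly_scale q.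
have nz_r : r != 0.
  by apply: contraTneq mon_q => r0; rewrite Dr r0 rmorph0 scaler0 monicE lead_coef0.
have rP (s : {poly int}) : root (ZtoC s) a = (r %| s).
  have ->: ZtoC s = map_poly ratr (map_poly intr s : {poly rat}).
    by rewrite -map_poly_comp; apply: eq_map_poly => z /=; rewrite ratr_int.
  rewrite qP Dr dvdpZl ?invr_eq0 ?intr_eq0 //.
  by rewrite dvdp_rat_int.
exists (zprimitive r); split.
- by rewrite zprimitive_eq0.
- by rewrite zcontents_primitive nz_r.
- by rewrite -sgz_gt0 sgz_lead_primitive nz_r.
- by rewrite rP {1}[r]zpolyEprim dvdpZl ?zcontents_eq0.
move=> s; rewrite rP {1}[r]zpolyEprim dvdpZl ?zcontents_eq0 //.
Qed.

Lemma ZtoC_inj : injective (ZtoC : {poly int} -> {poly algC}).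
Proof. by apply: map_inj_poly => //; apply: intr_inj. Qed.

Lemma ZtoC_eq0 (q : {poly int}) : (ZtoC q == 0) = (q == 0).
Proof. by rewrite -(inj_eq ZtoC_inj) rmorph0. Qed.

Lemma size_ZtoC (q : {poly int}) : size (ZtoC q) = size q.
Proof. by apply: size_map_inj_poly => //; apply: intr_inj. Qed.

Lemma lead_coef_ZtoC (q : {poly int}) : lead_coef (ZtoC q) = (lead_coef q)%:~R.
Proof. by apply: lead_coef_map_inj => //; apply: intr_inj. Qed.

(** The gcd of [p] and [q] vanishes at [z], so it is not constant. Since [a] is a root of a factor
    of [p = zprimitive (gcdp p q) * r] and [r] has smaller degree than [p], it is the gcd that [p]
    divides. *)
Lemma minpoly_conj (a : algC) (p q : {poly int}) (z : algC) :
  p != 0 -> (forall r : {poly int}, root (ZtoC r) a = (p %| r)) ->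
  root (ZtoC p) z -> root (ZtoC q) z -> root (ZtoC q) a.
Proof.
move=> p0 pa pz qz; rewrite pa.
have [k [u [l [nzk E]]]] : exists (k : int) (u l : {poly int}),
    k != 0 /\ k *: gcdp p q = u * p + l * q.
  have [[u0 v0] /= /eqpP[[c3 c4]/= /andP[nz3 nz4] E]] := Bezoutp p q.
  exists c4, (c3 *: u0), (c3 *: v0); split=> //.
  by rewrite -E scalerDr -!scalerAl.
have gz : root (ZtoC (gcdp p q)) z.
  have: root (ZtoC (k *: gcdp p q)) z.
    by rewrite E /root rmorphD !rmorphM /= !hornerE (eqP pz) (eqP qz) !mulr0 addr0.
  by rewrite -mul_polyC rmorphM /= map_polyC /= mul_polyC rootZ ?intr_eq0.
have nzg : gcdp p q != 0 by rewrite gcdp_eq0 negb_and p0.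
have sg : (1 < size (gcdp p q))%N.
  by rewrite -size_ZtoC (root_size_gt1 _ gz) // ZtoC_eq0.
have [r Dr] := dvdpP_int (dvdp_gcdl p q).
have : root (ZtoC (zprimitive (gcdp p q) * r)) a by rewrite -Dr pa.
rewrite rmorphM /= rootM !pa => /orP[pg|pr].
  apply: dvdp_trans (dvdp_gcdr p q).
  by rewrite [gcdp p q]zpolyEprim dvdpZr ?zcontents_eq0.
have nzr : r != 0 by apply: contraNneq p0 => r0; rewrite Dr r0 mulr0.
have := dvdp_leq nzr pr.
have : size p = size (zprimitive (gcdp p q) * r) by rewrite -Dr.
rewrite size_mul ?zprimitive_eq0 // size_zprimitive.
case: (size (gcdp p q)) sg => [|[|k1]] // _.
by rewrite !addSn /= => ->; rewrite ltnNge leq_addl.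
Qed.

(* det B(A) for the companion matrix A of P, computed by factoring either P or B. *)
Lemma prod_horner_roots_Crat (P : {poly rat}) (B : {poly rat}) (rs : seq algC) :
  map_poly ratr P = \prod_(z <- rs) ('X - z%:P) ->
  \prod_(z <- rs) (map_poly ratr B).[z] \in Crat.
Proof.
move=> DP.
have monP : P \is monic.
  have := monic_prod_XsubC rs xpredT id.
  by rewrite -DP map_monic.
(* A constant [P] has no roots and is set apart, because the companion matrix must have positive
   size. *)
case: (ltnP 1 (size P)) => sP; last first.
  have P1 : P = 1.
    have DP0 := size1_polyC sP; move: monP; rewrite DP0 monicE lead_coefC.
    by move=> /eqP->.
  move: DP; rewrite P1 rmorph1 => /(congr1 (fun q : {poly algC} => size q)).
  rewrite size_poly1 size_prod_XsubC => -[/esym /size0nil ->].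
  by rewrite big_nil rpred1.
have [d Dd] : exists d, (size P).-1 = d.+1 by exists (size P).-2; lia.
have [A DA] : exists A : 'M[rat]_(d.+1), char_poly A = P.
  have := companionmxK monP; move: (companionmx P); rewrite /= Dd => A0 <-; by exists A0.
have key : \det (map_mx ratr (horner_mx A B)) = \prod_(z <- rs) (map_poly ratr B).[z] :> algC.
  rewrite map_horner_mx.
  have DAC : char_poly (map_mx ratr A) = \prod_(z <- rs) ('X - z%:P) :> {poly algC}.
    by rewrite -map_char_poly DA.
  move: (map_mx ratr A) (map_poly ratr B) DAC => {B DP DA A monP} A B DA.
  have [bs ->] := closed_field_poly_normal B.
  have detX b : \det (A - b%:M) = \prod_(z <- rs) (z - b).
    have := congr1 (fun q : {poly algC} => q.[b]) DA.
    rewrite /char_poly -horner_evalE -det_map_mx /char_poly_mx.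
    rewrite map_mxB /= map_scalar_mx /= -map_mx_comp.
    have -> : map_mx (horner_eval b \o polyC) A = A.
      by apply/matrixP=> i j; rewrite !mxE /= horner_evalE hornerC.
    rewrite horner_evalE hornerX => E.
    have -> : A - b%:M = (-1) *: (b%:M - A) by rewrite scaleN1r opprB.
    have sz : size rs = d.+1.
      have := congr1 (fun q : {poly algC} => size q) DA.
      by rewrite size_char_poly size_prod_XsubC => -[].
    rewrite detZ E horner_prod -sz.
    elim: (rs) => [|z r IH]; first by rewrite !big_nil mul1r.
    rewrite !big_cons /= -IH exprS hornerXsubC; ring.
  move: (lead_coef B) => c.
  have -> : horner_mx A (c *: \prod_(b <- bs) ('X - b%:P)) = c *: \prod_(b <- bs) (A - b%:M).
    rewrite linearZ /= rmorph_prod; congr (_ *: _); apply: eq_bigr => b _.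
    by rewrite rmorphB /= horner_mx_X horner_mx_C.
  rewrite detZ.
  have -> : \det (\prod_(b <- bs) (A - b%:M)) = \prod_(b <- bs) \prod_(z <- rs) (z - b).
    elim: bs => [|b bs IH]; first by rewrite !big_nil det1.
    by rewrite !big_cons det_mulmx IH detX.
  have sz : size rs = d.+1.
    have := congr1 (fun q : {poly algC} => size q) DA.
    by rewrite size_char_poly size_prod_XsubC => -[].
  rewrite exchange_big -sz -[c ^+ _]/(c ^+ size rs).
  have -> : c ^+ size rs = \prod_(z <- rs) c by rewrite big_const_seq count_predT iter_mulr_1.
  rewrite -big_split /=.
  apply: eq_bigr => z _; rewrite hornerZ horner_prod; congr (_ * _).
  by apply: eq_bigr => b _; rewrite !hornerE.
by rewrite -key det_map_mx Crat_rat.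
Qed.

(** * Algebraic integers and simultaneous approximation *)

(* x stabilizes the finitely generated group spanned by 1, a, .., a^(r + deg P). *)
Lemma Aint_poly_invr (a x : algC) (P Q : {poly int}) (r : nat) :
  x = (ZtoC P).[a] -> x * a ^+ r = (ZtoC Q).[a] -> (size Q <= r.+1)%N -> x \in Aint.
Proof.
move=> DP DQ sQ.
have [P0|nzP] := eqVneq P 0.
  by rewrite DP P0 rmorph0 horner0 rpred0.
have [s Ds] : exists s, s.+1 = (r + size P)%N.
  by exists (r + size P).-1; rewrite prednK // addn_gt0 size_poly_gt0 nzP orbT.
(* [R i] has degree at most [s] and value [x * a ^+ i] at [a]; [Q] takes over once [a ^+ r] can be
   factored out. *)
pose R (i : nat) : {poly int} := if (i < r)%N then 'X^i * P else 'X^(i - r) * Q.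
have sR i : (i < s.+1)%N -> (size (R i) <= s.+1)%N.
  rewrite /R Ds; case: (ltnP i r) => ir ii.
    by rewrite mulrC size_mulXn //; lia.
  have [->|nzQ] := eqVneq Q 0; first by rewrite mulr0 size_poly0.
  by rewrite mulrC size_mulXn //; move: (size P) (size Q) ii sQ => u v; lia.
have Ra (i : nat) : (ZtoC (R i)).[a] = x * a ^+ i.
  rewrite /R; case: (ltnP i r) => ir; rewrite rmorphM /= map_polyXn !hornerE -?DP -?DQ.
    exact: mulrC.
  by rewrite mulrC -mulrA -exprD subnKC.
(* Multiplication by [x]: column [i] lists the coefficients of [R i], so the row of powers of [a] is
   a left eigenvector. *)
pose M : 'M[int]_(s.+1) := \matrix_(j, i) (R i)`_j.
have ev : eigenvalue (map_mx intr M) x.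
  apply/eigenvalueP; exists (\row_j a ^+ j).
    apply/rowP=> i; rewrite !mxE -Ra.
    have sRi : (size (ZtoC (R i)) <= s.+1)%N by rewrite size_ZtoC sR.
    rewrite (horner_coef_wide _ sRi); by apply: eq_bigr => j _; rewrite !mxE coef_map mulrC.
  apply/eqP => /rowP/(_ ord0); rewrite !mxE expr0 => /eqP; by rewrite oner_eq0.
move: ev; rewrite eigenvalue_root_char -map_char_poly => rx.
apply: root_monic_Aint rx _ _; first by rewrite monicE lead_coef_ZtoC (monicP (char_poly_monic M)).
by apply/polyOverP=> i; rewrite coef_map /= intr_int.
Qed.

(** Each [q * P_i] is rational and integral, hence an integer. So the denominator of [q], coprime to
    its numerator, divides all coefficients of [P], and then its content 1. *)
Lemma int_scaled_primitive (P : {poly int}) (q : algC) :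
  zcontents P = 1 -> q \in Crat -> (forall i, q * (P`_i)%:~R \in Aint) -> q \in Num.int.
Proof.
move=> P1 /CratP[c Dq] qP.
have dP : (denq c %| zcontents P)%Z.
  rewrite dvdz_contents; apply/polyOverP=> i.
  have : q * (P`_i)%:~R \in Num.int.
    by apply: Cint_rat_Aint => //; rewrite Dq rpredM ?Crat_rat // rpred_int.
  rewrite Dq => /intrP[m]; rewrite -(ratr_int algC) -rmorphM -(ratr_int algC m).
  move=> /fmorph_inj E.
  have : numq c * P`_i = m * denq c.
    apply: (@intr_inj rat); rewrite !rmorphM /= -E.
    rewrite {2}(esym (divq_num_den c)) mulrAC divfK ?intr_eq0 ?denq_eq0 //.
  move=> E2; have : (denq c %| numq c * P`_i)%Z by rewrite E2 dvdz_mull.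
  by rewrite Gauss_dvdzr // coprimezE coprime_sym coprime_num_den.
rewrite P1 in dP; have d1 : denq c = 1.
  by move: dP; rewrite dvdz1 => /eqP E; rewrite -[denq c]gez0_abs ?denq_ge0 // E.
by rewrite Dq -(divq_num_den c) d1 divr1 ratr_int intr_int.
Qed.

Lemma floor_eq_dist (x y : algC) : x \is Num.real -> y \is Num.real ->
  Num.floor x = Num.floor y -> `|x - y| <= 1.
Proof.
move=> xr yr E; have /andP[x1 x2] := real_floor_itv xr; have /andP[y1 y2] := real_floor_itv yr.
rewrite -E intrD in y1 y2; rewrite intrD in x2.
rewrite real_ler_norml ?rpredB // lerBlDr lerBrDr addrC lerBlDr.
by rewrite [1 + y]addrC !ltW // ?(lt_le_trans y2) ?(lt_le_trans x2) ?lerD2r.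
Qed.

(** Pigeonhole: for two exponents, the real and imaginary parts of the powers of every [z] fall in
    the same cells, and the difference of the exponents serves. The bound 2 adds the errors of the
    two coordinates. *)
Lemma dirichlet_unit_circle (rs : seq algC) (K : nat) :
  (forall z, z \in rs -> `|z| = 1) -> (0 < K)%N ->
  exists2 m, (0 < m)%N & forall z, z \in rs -> K%:R * `|z ^+ m - 1| <= 2.
Proof.
move=> rs1 K0.
(* For [x] in [[-1, 1]] the floor of [K x] lies between [-K] and [K]; the shift by [K] makes it an
   index below [2 * K + 1]. *)
pose cell (x : algC) : 'I_(2 * K).+1 := inord `|Num.floor (K%:R * x) + K%:Z|.
have cellP (x y : algC) : x \is Num.real -> y \is Num.real -> `|x| <= 1 -> `|y| <= 1 ->
    cell x = cell y -> K%:R * `|x - y| <= 1.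
  move=> xr yr x1 y1.
  have Kr (z : algC) : z \is Num.real -> K%:R * z \is Num.real by move=> zr; rewrite rpredM ?realn.
  have bnd (z : algC) : z \is Num.real -> `|z| <= 1 -> - K%:Z <= Num.floor (K%:R * z) <= K%:Z.
    move=> zr; rewrite real_ler_norml // => /andP[z1 z2]; apply/andP; split.
      rewrite real_floor_ge_int ?Kr // rmorphN /= -mulrN1 ler_wpM2l ?ler0n //.
    rewrite -ltzD1 real_floor_lt_int ?Kr // intrD (@le_lt_trans _ _ K%:R) ?ltrDl ?ltr01 //.
    by rewrite -[leRHS]mulr1 ler_wpM2l ?ler0n.
  have /andP[bx1 bx2] := bnd x xr x1; have /andP[by1 by2] := bnd y yr y1.
  move=> /(congr1 val); rewrite /cell /= !inordK; try lia.
  move=> E; rewrite -[K%:R in leLHS]normr_nat -normrM mulrBr.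
  apply: floor_eq_dist; rewrite ?Kr //.
  move: (Num.floor _) (Num.floor _) bx1 bx2 by1 by2 E => u v; lia.
pose T := {ffun 'I_(size rs) -> 'I_(2 * K).+1 * 'I_(2 * K).+1}.
pose f (m : 'I_(#|{: T}|.+1)) : T :=
  [ffun i : 'I_(size rs) => (cell ('Re (rs`_i ^+ m)), cell ('Im (rs`_i ^+ m)))].
have /injectivePn[x [y nxy fxy]] : ~~ injectiveb f.
  by apply/negP => /injectiveP/leq_card; rewrite card_ord ltnn.
wlog lt_yx : x y nxy fxy / (y < x)%N => [wl|].
  case: (ssrnat.ltngtP x y) => [xy|yx|/val_inj E]; last by rewrite E eqxx in nxy.
    by apply: (wl y x) => //; rewrite eq_sym.
  exact: (wl x y).
exists (x - y)%N; first by rewrite subn_gt0.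
move=> z zrs; have [i lti Di] : exists2 i, (i < size rs)%N & z = rs`_i.
  by move: zrs => /(nthP 0)[i]; exists i.
have z1 := rs1 z zrs.
have -> : `|z ^+ (x - y) - 1| = `|z ^+ x - z ^+ y|.
  have -> : z ^+ x - z ^+ y = z ^+ y * (z ^+ (x - y) - 1).
    by rewrite mulrBr -exprD subnKC ?(ltnW lt_yx) // mulr1.
  by rewrite normrM normrX z1 expr1n mul1r.
have := congr1 (fun g : T => g (Ordinal lti)) fxy; rewrite !ffunE /= -Di => -[E1 E2].
have n1 k : `|z ^+ k| = 1 by rewrite normrX z1 expr1n.
have reim k : `|'Re (z ^+ k)| ^+ 2 + `|'Im (z ^+ k)| ^+ 2 = 1.
  by rewrite !real_normK ?Creal_Re ?Creal_Im // -normC2_Re_Im n1 expr1n.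
have re1 k : `|'Re (z ^+ k)| <= 1.
  by rewrite -(@expr_le1 _ 2) ?normr_ge0 // -(reim k) lerDl exprn_ge0.
have im1 k : `|'Im (z ^+ k)| <= 1.
  by rewrite -(@expr_le1 _ 2) ?normr_ge0 // -(reim k) lerDr exprn_ge0.
have k1 := cellP _ _ (Creal_Re _) (Creal_Re _) (re1 x) (re1 y) E1.
have k2 := cellP _ _ (Creal_Im _) (Creal_Im _) (im1 x) (im1 y) E2.
rewrite -!raddfB /= in k1 k2; rewrite [_ - _]Crect.
apply: le_trans (_ : K%:R * (`|'Re (z ^+ x - z ^+ y)| + `|'Im (z ^+ x - z ^+ y)|) <= _).
  rewrite ler_wpM2l ?ler0n // (le_trans (ler_normD _ _)) // normrM normCi mul1r //.
by rewrite mulrDr lerD.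
Qed.

(** * The Mahler measure *)

Definition max1 (x : algC) : algC := Num.max 1 `|x|.

Lemma max1_ge1 x : 1 <= max1 x.
Proof. by rewrite /max1 /Order.max; case: ifP => // /ltW. Qed.

Lemma max1_ge_norm x : `|x| <= max1 x.
Proof.
rewrite /max1 /Order.max; case: ifP => // /negbT.
by rewrite -real_leNgt ?rpred1 ?normr_real.
Qed.

Lemma max1_gt0 x : 0 < max1 x.
Proof. exact: lt_le_trans ltr01 (max1_ge1 x). Qed.

Lemma max1X x n : max1 (x ^+ n) = max1 x ^+ n.
Proof.
rewrite /max1 /Order.max normrX.
have [lt1|le1] := real_ltP (rpred1 _) (normr_real x).
  case: n => [|n]; first by rewrite !expr0 ltxx.
  by rewrite exprn_egt1.
by rewrite expr1n le_gtF // exprn_ile1.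
Qed.

Lemma horner_norm_le (Q : {poly int}) (x : algC) e : (size Q <= e.+1)%N ->
  `|(ZtoC Q).[x]| <= (\sum_(i < e.+1) `|(Q`_i)%:~R|) * max1 x ^+ e.
Proof.
move=> sQ; rewrite (@horner_coef_wide _ e.+1) ?size_ZtoC // mulr_suml.
apply: le_trans (ler_norm_sum _ _ _) _; apply: ler_sum => i _.
rewrite normrM coef_map /= ler_wpM2l // normrX.
apply: le_trans (_ : max1 x ^+ i <= _).
  by rewrite lerXn2r ?nnegrE ?max1_ge_norm ?normr_ge0 // ltW ?max1_gt0.
by rewrite ler_weXn2l ?max1_ge1 // -ltnS.
Qed.

Lemma zcontentsX (p : {poly int}) k : zcontents p = 1 -> zcontents (p ^+ k) = 1.
Proof.
move=> p1; elim: k => [|k IH]; last by rewrite exprS zcontentsM p1 IH mul1r.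
by rewrite expr0 zcontents_monic ?monic1.
Qed.

(** By the binomial formula the coefficients are integer multiples of the [w * z ^+ j]; the
    induction peels off one factor at a time. *)
Lemma polyOver_Aint_shift (k : nat) (w z : algC) :
  (forall j, (j <= k)%N -> w * z ^+ j \in Aint) ->
  w *: ('X - z%:P) ^+ k \is a polyOver Aint.
Proof.
elim: k w => [|k IH] w wz.
  rewrite expr0 -mul_polyC mulr1 polyOverC; have := wz 0%N isT; by rewrite mulr1.
have -> : w *: ('X - z%:P) ^+ k.+1 = 'X * (w *: ('X - z%:P) ^+ k) - (w * z) *: ('X - z%:P) ^+ k.
  rewrite -!mul_polyC polyCM exprS; ring.
rewrite rpredB // ?rpredM ?polyOverX // IH // => j jk; first by apply: wz; lia.
by rewrite -mulrA -exprS; apply: wz; lia.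
Qed.

Section Primitive.
Variables (p : {poly int}) (rs : seq algC).
Hypotheses (p1 : zcontents p = 1) (lc0 : 0 < lead_coef p).
Hypothesis (Dp : ZtoC p = (lead_coef p)%:~R *: \prod_(z <- rs) ('X - z%:P)).

Let nzlc : (lead_coef p)%:~R != 0 :> algC.
Proof. by rewrite intr_eq0; rewrite gt_eqF. Qed.

Lemma prod_horner_int_roots_Crat (B : {poly int}) :
  \prod_(z <- rs) (ZtoC B).[z] \in Crat.
Proof.
have ratZ (q : {poly int}) : map_poly ratr (map_poly intr q : {poly rat}) = ZtoC q.
  by rewrite -map_poly_comp; apply: eq_map_poly => z /=; rewrite ratr_int.
under eq_bigr do rewrite -ratZ.
apply: (@prod_horner_roots_Crat ((lead_coef p)%:~R^-1 *: map_poly intr p)).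
rewrite -mul_polyC rmorphM /= map_polyC /= ratZ Dp fmorphV /= ratr_int mul_polyC.
by rewrite scalerA mulVf // scale1r.
Qed.

(* [prod_z B(z) (X - z)^k] has algebraic integer coefficients and is a rational
   multiple of the primitive polynomial [p ^ k]. *)
Lemma lead_coefX_dvd_prod (B : {poly int}) (k : nat) :
  (forall z, z \in rs -> forall j, (j <= k)%N -> (ZtoC B).[z] * z ^+ j \in Aint) ->
  (\prod_(z <- rs) (ZtoC B).[z]) / (lead_coef p)%:~R ^+ k \in Num.int.
Proof.
move=> wz; set q := _ / _.
apply: (@int_scaled_primitive (p ^+ k)); first exact: zcontentsX.
  by rewrite rpred_div ?prod_horner_int_roots_Crat // rpredX // rpred_int.
have : \prod_(z <- rs) ((ZtoC B).[z] *: ('X - z%:P) ^+ k) \is a polyOver Aint.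
  by rewrite big_seq rpred_prod // => z zrs; apply/polyOver_Aint_shift/wz.
rewrite scaler_prod prodrXl.
have -> : \prod_(z <- rs) ('X - z%:P) = (lead_coef p)%:~R^-1 *: ZtoC p.
  by rewrite Dp scalerA mulVf // scale1r.
rewrite exprZn scalerA exprVn -/q => /polyOverP qP i.
by have := qP i; rewrite coefZ -rmorphXn coef_map.
Qed.

Lemma root_in_rs z : root (ZtoC p) z = (z \in rs).
Proof. by rewrite Dp rootZ // root_prod_XsubC. Qed.

Hypothesis (rs_nz : forall z, z \in rs -> z != 0).
Hypothesis (rs_nu : forall z, z \in rs -> forall n, (0 < n)%N -> z ^+ n != 1).
Hypothesis (rs_ne : exists z, z \in rs).

(** Kronecker's theorem. Were the Mahler measure at most 1, [p] would be monic with all roots on the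
    unit circle. A common exponent [m] bringing all their powers near 1 makes the product of the
    [z ^+ m - 1] an integer of absolute value below 1, hence 0, and some root is a root of unity. *)
Lemma mahler_gt1 : 1 < (lead_coef p)%:~R * \prod_(z <- rs) max1 z :> algC.
Proof.
set l := _%:~R; have l1 : 1 <= l by rewrite /l ler1z -gtz0_ge1.
have l0 : 0 < l := lt_le_trans ltr01 l1.
have prod1 s : 1 <= \prod_(z <- s) max1 z.
  elim: s => [|y s IH]; first by rewrite big_nil.
  by rewrite big_cons mulr_ege1 ?max1_ge1.
have pr : l * \prod_(z <- rs) max1 z \is Num.real.
  by rewrite rpredM ?ger0_real ?ltW // (lt_le_trans ltr01 (prod1 _)).
have [//|le1] := real_ltP (rpred1 _) pr.
have l_eq1 : l = 1.
  by apply/le_anti; rewrite l1 andbT (le_trans _ le1) // -[leLHS]mulr1 ler_wpM2l // ltW.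
have le1' z : z \in rs -> `|z| <= 1.
  move=> zrs; apply: le_trans (max1_ge_norm z) (le_trans _ le1).
  rewrite l_eq1 mul1r (big_rem z zrs) /= -[leLHS]mulr1 ler_wpM2l ?prod1 //.
  exact/ltW/max1_gt0.
have prodle1 (s : seq algC) (f : algC -> algC) :
    {in s, forall z, `|f z| <= 1} -> `|\prod_(z <- s) f z| <= 1.
  elim: s => [|y s IH] H; first by rewrite big_nil normr1.
  rewrite big_cons normrM mulr_ile1 ?normr_ge0 //; first by rewrite H ?mem_head.
  by apply: IH => u us; apply: H; rewrite inE us orbT.
have Dp1 : ZtoC p = \prod_(z <- rs) ('X - z%:P) by rewrite Dp -/l l_eq1 scale1r.
(* The constant term is a nonzero integer and, up to sign, the product of the roots, none of which
   exceeds 1 in modulus. *)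
have eq1 z : z \in rs -> `|z| = 1.
  move=> zrs; apply/le_anti; rewrite le1' //=.
  have : 1 <= `|(ZtoC p)`_0|.
    rewrite coef_map /= -intr_norm ler1z -gtz0_ge1 normr_gt0.
    apply/negP => /eqP p00.
    have : root (ZtoC p) 0 by rewrite /root horner_coef0 coef_map /= p00.
    by rewrite root_in_rs => /rs_nz; rewrite eqxx.
  rewrite -horner_coef0 Dp1 horner_prod (big_rem z zrs) /= normrM.
  rewrite !hornerE normrN => /le_trans-> //.
  rewrite -[leRHS]mulr1 ler_wpM2l // prodle1 // => u /mem_rem urs.
  by rewrite !hornerE normrN le1'.
(* The choice 3 gives distances at most 2/3, below 1. *)
have [m m0 mP] := dirichlet_unit_circle eq1 (isT : 0 < 3)%N.
have small z : z \in rs -> `|z ^+ m - 1| < 1.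
  move=> zrs; have := mP z zrs; rewrite -ler_pdivlMl ?ltr0n // => /le_lt_trans-> //.
  by rewrite mulrC ltr_pdivrMr ?ltr0n // mul1r ltr_nat.
have int_prod : \prod_(z <- rs) (z ^+ m - 1) \in Num.int.
  apply: Cint_rat_Aint.
    have -> : \prod_(z <- rs) (z ^+ m - 1) = \prod_(z <- rs) (ZtoC ('X^m - 1)).[z].
      by apply: eq_bigr => z _; rewrite rmorphB /= map_polyXn rmorph1 !hornerE.
    exact: prod_horner_int_roots_Crat.
  rewrite big_seq rpred_prod // => z zrs; rewrite rpredB ?rpred1 // rpredX //.
  apply: (@root_monic_Aint (ZtoC p)); rewrite ?root_in_rs //.
    by rewrite Dp1 monic_prod_XsubC.
  by apply/polyOverP=> i; rewrite coef_map /= intr_int.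
have [a ars] := rs_ne.
have : `|\prod_(z <- rs) (z ^+ m - 1)| < 1.
  rewrite (big_rem a ars) /= normrM.
  apply: le_lt_trans (small a ars); rewrite -[leRHS]mulr1 ler_wpM2l // prodle1 // => u.
  by move=> /mem_rem urs; apply/ltW/small.
have [/eqP|nz] := eqVneq (\prod_(z <- rs) (z ^+ m - 1)) 0.
  rewrite prodf_seq_eq0 => /hasP[z zrs /=].
  by rewrite subr_eq0 (negPf (rs_nu zrs m0)).
by have := norm_intr_ge1 int_prod nz => /le_gtF ->.
Qed.

End Primitive.

(** * Vanishing of elements of small degree of (F, t^n - 1) *)

Lemma expr_unbounded (M K : algC) : 1 < M -> 0 <= K ->
  exists n, forall m, (n <= m)%N -> K < M ^+ m.
Proof.
move=> M1 K0; have d0 : 0 < M - 1 by rewrite subr_gt0.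
have Kd : 0 <= K / (M - 1) by rewrite divr_ge0 // ltW.
exists (Num.bound (K / (M - 1))) => m le_m.
have bern : 1 + m%:R * (M - 1) <= M ^+ m.
  elim: m {le_m} => [|m IH]; first by rewrite mul0r addr0 expr0.
  rewrite exprS; apply: le_trans (_ : M * (1 + m%:R * (M - 1)) <= _).
    rewrite -subr_ge0.
    have -> : M * (1 + m%:R * (M - 1)) - (1 + m.+1%:R * (M - 1)) = m%:R * (M - 1) ^+ 2.
      by rewrite -natr1; ring.
    by rewrite mulr_ge0 ?ler0n // exprn_ge0 // ltW.
  by rewrite ler_wpM2l // (le_trans ler01 (ltW M1)).
apply: lt_le_trans bern; apply: lt_le_trans (_ : m%:R * (M - 1) <= _); last first.
  by rewrite lerDr ler01.
rewrite -ltr_pdivrMr //; apply: lt_le_trans (archi_boundP Kd) _.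
by rewrite ler_nat.
Qed.

Lemma pos_lower_bound (rs : seq algC) (f : algC -> algC) :
  (forall z, z \in rs -> 0 < f z) ->
  exists2 e, 0 < e & forall z, z \in rs -> e <= f z.
Proof.
elim: rs => [|y rs IH] f0; first by exists 1.
have [|e e0 eP] := IH; first by move=> z zrs; apply: f0; rewrite inE zrs orbT.
have fy : 0 < f y by apply: f0; rewrite mem_head.
(* This lies below both [e] and [f y] and avoids a minimum in the partially ordered [algC]. *)
exists (e^-1 + (f y)^-1)^-1; first by rewrite invr_gt0 addr_gt0 ?invr_gt0.
have le c b : 0 < c -> 0 < b -> (c^-1 + b^-1)^-1 <= c :> algC.
  move=> c0 b0; rewrite -[leRHS]invrK lef_pV2 ?posrE ?addr_gt0 ?invr_gt0 //.
  by rewrite lerDl ltW // invr_gt0.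
move=> z; rewrite inE => /orP[/eqP->|/eP]; first by rewrite addrC le.
exact/le_trans/le.
Qed.

(** Off the unit circle the bound holds for every [n > 0]. On the circle, [n] is chosen so that
    [z ^+ n] is close to [z ^+ N], which differs from 1. *)
Lemma norm_expr_sub1_lower (rs : seq algC) (N : nat) : (0 < N)%N ->
  (forall z, z \in rs -> forall n, (0 < n)%N -> z ^+ n != 1) ->
  exists2 d, 0 < d & forall L, exists n, [/\ (L < n)%N, (N %| n)%N &
    forall z, z \in rs -> d * max1 z ^+ n <= `|z ^+ n - 1|].
Proof.
move=> N0 nu.
pose f (z : algC) : algC :=
  if `|z| < 1 then 1 - `|z| else if 1 < `|z| then 1 - `|z|^-1 else `|z ^+ N - 1|.
have [|e e0 eP] := @pos_lower_bound rs f; first move=> z zrs.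
  rewrite /f; case: ifP => [?|_]; first by rewrite subr_gt0.
  case: ifP => [z1|_]; first by rewrite subr_gt0 invf_lt1 // (lt_trans ltr01).
  by rewrite normr_gt0 subr_eq0 nu.
exists (e / 2); first by rewrite divr_gt0 ?ltr0n.
move=> L.
(* Adding to [N] a positive multiple of [N * L.+1] keeps [n] divisible by [N] and larger than
   [L]. *)
pose us := [seq z ^+ (N * L.+1) | z <- rs & `|z| == 1].
have us1 u : u \in us -> `|u| = 1.
  case/mapP=> z; rewrite mem_filter => /andP[/eqP z1 _] ->.
  by rewrite normrX z1 expr1n.
(* With [K > 4 / e] the approximation error [2 / K] is at most [e / 2], half of the lower bound for
   [z ^+ N - 1]. *)
have K0 : 0 <= 4 / e by rewrite divr_ge0 ?ler0n // ltW.
have KP := archi_boundP K0; set K := Num.bound _ in KP.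
have Kp : (0 < K)%N by rewrite -(ltr_nat algC) (le_lt_trans K0).
have [m m0 mP] := dirichlet_unit_circle us1 Kp.
exists (N + N * L.+1 * m)%N; split.
- by nia.
- by rewrite dvdn_add // -mulnA dvdn_mulr.
set n := (_ + _)%N => z zrs; have n0 : (0 < n)%N by rewrite addn_gt0 N0.
have := eP z zrs; rewrite /f.
have e2 : e / 2 <= e by rewrite ler_pdivrMr ?ltr0n // ler_peMr ?ler1n // ltW.
case: ifP => [z1|nz1].
  move=> ez; have -> : max1 z = 1 by rewrite /max1 /Order.max (lt_gtF z1).
  rewrite expr1n mulr1 distrC; apply: le_trans (lerB_dist _ _).
  rewrite normr1 normrX; apply: le_trans e2 (le_trans ez _).
  rewrite lerD2l lerN2 -[leRHS]expr1 ler_wiXn2l //; exact: ltW.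
case: ifP => [z1|nz2].
  move=> ez; have -> : max1 z = `|z| by rewrite /max1 /Order.max z1.
  have zp : 0 < `|z| by apply: lt_trans z1; rewrite ltr01.
  apply: le_trans (lerB_dist _ _); rewrite normr1 normrX.
  apply: le_trans (_ : (1 - `|z|^-1) * `|z| ^+ n <= _).
    by rewrite ler_wpM2r ?exprn_ge0 // (le_trans e2).
  rewrite mulrBl mul1r lerD2l lerN2 -(prednK n0) exprS mulrA mulVf ?gt_eqF // mul1r.
  by rewrite exprn_ege1 // ltW.
have z1 : `|z| = 1.
  by have [] := real_ltgtP (rpred1 _) (normr_real z); rewrite ?nz1 ?nz2.
have -> : max1 z = 1 by rewrite /max1 /Order.max z1 ltxx.
rewrite expr1n mulr1 => ez.
have -> : z ^+ n - 1 = (z ^+ N - 1) + z ^+ N * ((z ^+ (N * L.+1)) ^+ m - 1).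
  by rewrite /n exprD exprM; ring.
apply: le_trans (lerB_normD _ _); rewrite normrM normrX z1 expr1n mul1r.
have uz : z ^+ (N * L.+1) \in us by apply/mapP; exists z; rewrite // mem_filter z1 eqxx.
have Kz := mP _ uz.
have : `|(z ^+ (N * L.+1)) ^+ m - 1| <= e / 2.
  have Kr : 0 < K%:R :> algC by rewrite ltr0n.
  rewrite -ler_pdivlMl // in Kz; apply: le_trans Kz _.
  rewrite ler_pdivrMl // mulrA ler_pdivlMr ?ltr0n //.
  by move: KP; rewrite ltr_pdivrMr // => /ltW; rewrite -natrM.
rewrite lerBrDr => H; apply: le_trans ez.
apply: le_trans (_ : e / 2 + e / 2 <= _); first by rewrite lerD2l.
by rewrite -splitr.
Qed.

(** Membership in the ideal generated by [F] at the level [(Z/m)[Z/n]], lifted to [Z[X]]. *)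
Definition in_ideal (F : {poly int}) (m n : nat) (H : {poly int}) : Prop :=
  exists A B C : {poly int}, H = A * F + B * m%:R + C * ('X^n - 1).

Lemma size_Xn_sub1_int n : (0 < n)%N -> size ('X^n - 1 : {poly int}) = n.+1.
Proof. by move=> n0; rewrite -polyC1 size_XnsubC. Qed.

(** Here [n] is fixed before [H] and [D]. If [H] did not vanish at [a], then [H = A p + B (X^n - 1)]
    where the product of the [|B(z)|] is at least [l ^+ k] by integrality, and equals the quotient
    of the products for [H] and [X^n - 1]. This bounds [M ^+ (n - D)], against [M > 1]. *)
Lemma in_ideal_vanish (F : {poly int}) (a : algC) (N : nat) (B0 : algC) :
  root (ZtoC F) a -> a != 0 -> (forall n, (0 < n)%N -> a ^+ n != 1) ->
  (0 < N)%N -> 0 <= B0 ->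
  exists n, [/\ (1 < n)%N, (N %| n)%N & forall (H : {poly int}) (D : nat),
    (size H <= D.+1)%N -> (2 * D <= n)%N ->
    (forall x : algC, `|(ZtoC H).[x]| <= B0 * max1 x ^+ D) ->
    (forall m, (1 < m)%N -> in_ideal F m n H) -> root (ZtoC H) a].
Proof.
move=> Fa nza nua N0 B00.
have [p [p0 p1 lc0 pa0 pa]] := int_minpoly a.
have [rs Drs] := closed_field_poly_normal (ZtoC p).
rewrite lead_coef_ZtoC in Drs.
have in_rs := root_in_rs lc0 Drs.
have conj (q : {poly int}) z : z \in rs -> root (ZtoC q) z -> root (ZtoC q) a.
  by rewrite -in_rs; apply: minpoly_conj.
have rs_nz z : z \in rs -> z != 0.
  move=> zrs; apply: contraNneq nza => z0.
  have := conj 'X z zrs; rewrite map_polyX /root !hornerX z0 eqxx => /(_ isT).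
  by [].
have rs_nu z : z \in rs -> forall n, (0 < n)%N -> z ^+ n != 1.
  move=> zrs n n0; apply: contraNneq (nua n n0) => zn.
  have := conj ('X^n - 1) z zrs.
  rewrite rmorphB /= map_polyXn rmorph1 /root !hornerE zn subrr eqxx => /(_ isT).
  by rewrite subr_eq0.
have rs_ne : exists z, z \in rs by exists a; rewrite -in_rs.
have M1 := mahler_gt1 lc0 Drs rs_nz rs_nu rs_ne.
set l := (lead_coef p)%:~R in M1 Drs; set P := \prod_(z <- rs) max1 z in M1.
set M := l * P in M1.
have l1 : 1 <= l by rewrite /l ler1z -gtz0_ge1.
have l0 : 0 < l := lt_le_trans ltr01 l1.
have P0 : 0 < P by apply: prodr_gt0 => z _; apply: max1_gt0.
pose d := size rs.
have sp : size p = d.+1.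
  by rewrite -size_ZtoC Drs size_scale ?gt_eqF // size_prod_XsubC.
have [e e0 eP] := norm_expr_sub1_lower N0 rs_nu.
(* This is the bound on [M ^+ (n - D)] reached at the end. *)
have K0 : 0 <= (B0 * l) ^+ d / e ^+ d.
  by rewrite divr_ge0 ?exprn_ge0 ?mulr_ge0 // ltW.
have [n0 n0P] := expr_unbounded M1 K0.
(* As [2 * D <= n], this gives [n - D > n0 + d], so the subtraction [n - D - d] below is not
   truncated. *)
have [n [Ln Nn nP]] := eP (2 * n0 + 2 * d + 2)%N.
exists n; split=> //; first by clear -Ln; lia.
move=> H D sH D2 HB Hin.
apply/negPn/negP => nHa.
have nH z : z \in rs -> (ZtoC H).[z] != 0 by move=> /(conj H) cH; apply: contra nHa.
have np : (0 < n)%N by clear -Ln; lia.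
pose X1 : {poly int} := 'X^n - 1.
have sX1 : size X1 = n.+1 by apply: size_Xn_sub1_int.
have X1mon : X1 \is monic by rewrite monic_Xn_sub_1.
have DX1 z : (ZtoC X1).[z] = z ^+ n - 1 by rewrite rmorphB /= map_polyXn rmorph1 !hornerE.
have [r DF] : exists r, F = p * r.
  move: Fa; rewrite pa => /dvdpP_int[r ->]; exists r; congr (_ * _).
  by rewrite [RHS]zpolyEprim p1 scale1r.
(* No root of [p] is a root of unity, so [p] and [X1] are coprime and their ideal contains a nonzero
   integer [c]. *)
have [u [v [c [nzc Dc]]]] : exists (u v : {poly int}) (c : int), c != 0 /\ u * p + v * X1 = c%:P.
  have : coprimep p X1.
    rewrite coprimep_def; apply: contraT => sg1.
    have nzg : gcdp p X1 != 0 by rewrite gcdp_eq0 negb_and p0.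
    have [z gz] : exists z, root (ZtoC (gcdp p X1)) z.
      apply/closed_rootP; rewrite size_ZtoC //.
    have dvdC (q : {poly int}) : gcdp p X1 %| q -> root (ZtoC q) z.
      case/dvdpP_int=> s ->; rewrite rmorphM /= rootM; apply/orP; left.
      move: gz; rewrite {1}[gcdp p X1]zpolyEprim -mul_polyC rmorphM /= map_polyC /= mul_polyC.
      by rewrite rootZ // intr_eq0 zcontents_eq0.
    have pz := dvdC p (dvdp_gcdl _ _); rewrite in_rs in pz.
    have := dvdC X1 (dvdp_gcdr _ _); rewrite /root DX1 subr_eq0.
    by rewrite (negPf (rs_nu z pz n np)).
  move/Bezout_coprimepP => [[u v] /= /eqpP[[c1 c2] /= /andP[nz1 nz2] E]].
  exists (c1 *: u), (c1 *: v), c2; split=> //.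
  by rewrite -!scalerAl -scalerDr E alg_polyC.
have [A [B [DH sA]]] : exists A B : {poly int}, H = A * p + B * X1 /\ (size A <= n)%N.
  (* For a modulus divisible by [c], the term in the modulus is absorbed by [p] and [X1]; the factor
     2 makes the modulus exceed 1. *)
  have [|A1 [A2 [A3 E]]] := Hin (2 * `|c|)%N.
    by rewrite -absz_gt0 in nzc; clear -nzc; lia.
  pose s : {poly int} := (2 * Num.sg c)%:P * A2.
  have Es : A2 * (2 * `|c|)%N%:R = s * u * p + s * v * X1.
    have -> : s * u * p + s * v * X1 = s * c%:P by rewrite -Dc; ring.
    have -> : s * c%:P = A2 * (2 * Num.sg c * c)%:P by rewrite /s !polyCM; ring.
    have -> : 2 * Num.sg c * c = (2 * `|c|)%N%:R by rewrite [RHS]natz PoszM abszE normrEsg mulrA.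
    by rewrite polyC_natr.
  pose A' := A1 * r + s * u; pose B' := A3 + s * v.
  have E' : H = A' * p + B' * X1 by rewrite E Es DF /A' /B' -/X1; ring.
  exists (Pdiv.Ring.rmodp A' X1), (B' + Pdiv.Ring.rdivp A' X1 * p).
  split; last by rewrite -ltnS -sX1 Pdiv.Ring.ltn_rmodpN0 // monic_neq0.
  rewrite E' {1}(Pdiv.RingMonic.rdivp_eq X1mon A'); ring.
(* [B * X1 = H - A * p] has degree below [n + d], and [X1] is monic of degree [n]. *)
have sB : (size B <= d)%N.
  have [->|nzB] := eqVneq B 0; first by rewrite size_poly0.
  have : (size (B * X1)%R <= n + d)%N.
    have -> : B * X1 = H - A * p by rewrite DH; ring.
    apply: leq_trans (size_polyD _ _) _; rewrite size_polyN geq_max; apply/andP; split.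
      by apply: leq_trans sH _; clear -D2 np; lia.
    by apply: leq_trans (size_polyMleq _ _) _; rewrite sp; move: (size A) sA => s; clear; lia.
  by rewrite size_Mmonic // sX1; move: (size B) => b; clear; lia.
have wz z : z \in rs -> (ZtoC B).[z] * (z ^+ n - 1) = (ZtoC H).[z].
  move=> zrs; rewrite DH rmorphD !rmorphM /= !hornerE DX1.
  by have := zrs; rewrite -in_rs => /eqP->; rewrite mulr0 add0r.
(* For w = B(z) and j <= k, w z^j is a polynomial in z and, since
   w z^n = (H + B)(z), also a polynomial in 1/z; hence it is integral. *)
pose k := (n - D - d)%N.
have := @lead_coefX_dvd_prod p rs p1 lc0 Drs B k.
set q := _ / _ => qP; have {}qP : q \in Num.int.
  apply: qP => z zrs j jk.
  apply: (@Aint_poly_invr z _ (B * 'X^j) (H + B) (n - j)).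
  - by rewrite rmorphM /= map_polyXn !hornerE.
  - rewrite -mulrA -exprD subnKC; last by rewrite /k in jk; clear -jk; lia.
    rewrite rmorphD /= hornerD -wz //; ring.
  - apply: leq_trans (size_polyD _ _) _; have jk' : (j <= n - D - d)%N by [].
    rewrite geq_max (leq_trans sH) ?(leq_trans sB) //; clear -jk' D2 Ln; lia.
have nzw z : z \in rs -> (ZtoC B).[z] != 0.
  by move=> zrs; apply: contraNneq (nH z zrs) => w0; rewrite -wz // w0 mul0r.
have nzq : q != 0.
  apply: mulf_neq0; last by rewrite invr_eq0 expf_neq0 ?gt_eqF.
  by rewrite prodf_seq_neq0; apply/allP => z /nzw.
have lk : l ^+ k <= \prod_(z <- rs) `|(ZtoC B).[z]|.
  have := norm_intr_ge1 qP nzq; rewrite /q normf_div normr_prod normrX (gtr0_norm l0).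
  by rewrite ler_pdivlMr ?exprn_gt0 // mul1r.
have eM : e ^+ d * P ^+ n <= \prod_(z <- rs) `|z ^+ n - 1|.
  have -> : e ^+ d * P ^+ n = \prod_(z <- rs) (e * max1 z ^+ n).
    by rewrite big_split /= prodrXl big_const_seq count_predT iter_mulr_1.
  by rewrite !big_seq; apply: ler_prod => z zrs; rewrite nP // mulr_ge0 ?exprn_ge0 ?ltW ?max1_gt0.
have HM : \prod_(z <- rs) `|(ZtoC H).[z]| <= B0 ^+ d * P ^+ D.
  have -> : B0 ^+ d * P ^+ D = \prod_(z <- rs) (B0 * max1 z ^+ D).
    by rewrite big_split /= prodrXl big_const_seq count_predT iter_mulr_1.
  by apply: ler_prod => z _; rewrite normr_ge0 HB.
have main : l ^+ k * (e ^+ d * P ^+ n) <= B0 ^+ d * P ^+ D.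
  apply: le_trans HM.
  have -> : \prod_(z <- rs) `|(ZtoC H).[z]|
      = \prod_(z <- rs) `|(ZtoC B).[z]| * \prod_(z <- rs) `|z ^+ n - 1|.
    by rewrite -big_split /= !big_seq; apply: eq_bigr => z zrs; rewrite -wz // normrM.
  by rewrite ler_pM // ?mulr_ge0 ?exprn_ge0 // ltW.
(* The factor [l ^+ d] completing [l ^+ k] to [l ^+ (n - D)] accounts for the [l] in the bound. *)
have : M ^+ (n - D) <= (B0 * l) ^+ d / e ^+ d.
  rewrite ler_pdivlMr ?exprn_gt0 // -(ler_pM2r (exprn_gt0 D P0)).
  have -> : (B0 * l) ^+ d * P ^+ D = l ^+ d * (B0 ^+ d * P ^+ D) by rewrite exprMn; ring.
  have -> : M ^+ (n - D) * e ^+ d * P ^+ D = l ^+ d * (l ^+ k * (e ^+ d * P ^+ n)).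
    have En : n = (n - D + D)%N by clear -D2; lia.
    have Ek : (n - D)%N = (d + k)%N by rewrite /k; clear -D2 Ln; lia.
    by rewrite /M exprMn [X in _ = _ * (_ * (_ * P ^+ X))]En exprD Ek exprD; ring.
  by rewrite ler_pM2l ?exprn_gt0.
have := n0P (n - D)%N; rewrite (_ : (n0 <= n - D)%N = true); last by clear -Ln D2; lia.
by move=> /(_ isT) /lt_geF->.
Qed.

(** * Auxiliary polynomials *)

(* [1, X^a, ..., X^(a deg G)] are linearly dependent modulo G. *)
Lemma exists_comp_Xn_multiple (G : {poly int}) (a : nat) : G != 0 ->
  exists Q : {poly int}, [/\ Q != 0, (size Q <= size G)%N & exists R, Q \Po 'X^a = R * G].
Proof.
move=> nzG; pose G0 : {poly rat} := map_poly intr G.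
have sG0 : size G0 = size G by apply: size_map_inj_poly => //; apply: intr_inj.
have nzG0 : G0 != 0 by rewrite -size_poly_eq0 sG0 size_poly_eq0.
pose e := (size G).-1; have De : size G = e.+1 by rewrite prednK // size_poly_gt0.
(* The rows are [e + 1] residues modulo [G0] in a space of dimension [e], so they satisfy a nonzero
   relation [u]. *)
pose M : 'M[rat]_(e.+1, e) := \matrix_j poly_rV (('X^a) ^+ j %% G0).
have [u /sub_kermxP uM nzu] : exists2 u : 'rV_(e.+1), (u <= kermx M)%MS & u != 0.
  apply/rowV0Pn; rewrite -mxrank_eq0 mxrank_ker -lt0n subn_gt0.
  by rewrite ltnS rank_leq_col.
pose q0 := rVpoly u.
have sq0 : (size q0 <= e.+1)%N by apply: size_poly.
have nzq0 : q0 != 0.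
  by apply: contraNneq nzu => q00; rewrite -[u]rVpolyK -/q0 q00 linear0.
have dG0 : G0 %| q0 \Po 'X^a.
  rewrite comp_polyE (big_ord_widen_cond e.+1 xpredT (fun i => q0`_i *: 'X^a ^+ i)) //.
  rewrite big_mkcond /=.
  have -> : \sum_(i < e.+1) (if (i < size q0)%N then q0`_i *: 'X^a ^+ i else 0)
      = \sum_(i < e.+1) u 0 i *: 'X^a ^+ i.
    apply: eq_bigr => i _; rewrite -coef_rVpoly_ord -/q0; case: ltnP => // le_i.
    by rewrite nth_default // scale0r.
  under eq_bigr do rewrite (divp_eq ('X^a ^+ _) G0) scalerDr scalerAl.
  rewrite big_split /= -mulr_suml dvdp_add ?dvdp_mull //.
  suff -> : \sum_(i < e.+1) u 0 i *: ('X^a ^+ i %% G0) = 0 by apply: dvdp0.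
  rewrite -[RHS](linear0 (@rVpoly rat e)) -uM mulmx_sum_row linear_sum.
  apply: eq_bigr => i _; rewrite linearZ /= rowK poly_rV_K //.
  have mod_small (P : {poly rat}) : (size (P %% G0)%R <= e)%N.
    by rewrite -ltnS -De -sG0 ltn_modp.
  exact: mod_small.
have [q [c nzc Dq]] := rat_poly_scale q0.
have dG : G %| q \Po 'X^a.
  rewrite -dvdp_rat_int map_comp_poly map_polyXn -/G0.
  by move: dG0; rewrite Dq comp_polyZ dvdpZr ?invr_eq0 ?intr_eq0.
have [r Dr] := dvdpP_int dG.
(* The quotient [r] is relative to the primitive part of [G]; the factor [zcontents G] restores
   divisibility by [G] itself. *)
exists (zcontents G *: q); split.
- rewrite scale_poly_eq0 zcontents_eq0 (negPf nzG) /=.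
  by apply: contraNneq nzq0 => q00; rewrite Dq q00 rmorph0 scaler0.
- apply: leq_trans (size_scale_leq _ _) _; rewrite De (leq_trans _ sq0) //.
  rewrite Dq size_scale ?invr_eq0 ?intr_eq0 // size_map_inj_poly //; exact: intr_inj.
by exists r; rewrite comp_polyZ Dr scalerAl -zpolyEprim mulrC.
Qed.

(** The [C + 1] multiples [i * k] modulo [n] fall into [C] intervals of length [n / C], so two share
    one. The sign tells which of the two remainders is larger. *)
Lemma thue_pigeonhole (n k C : nat) : (0 < n)%N -> (0 < C)%N ->
  exists a b : nat, [/\ (0 < a <= C)%N, (b * C < n)%N &
    (a * k = b %[mod n])%N \/ (a * k + b = 0 %[mod n])%N].
Proof.
move=> n0 C0; have fP (i : 'I_C.+1) : ((i * k) %% n * C %/ n < C)%N.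
  by rewrite ltn_divLR // mulnC ltn_pmul2l // ltn_pmod.
pose f i := Ordinal (fP i).
have /injectivePn[i [j nij fij]] : ~~ injectiveb f.
  by apply/negP => /injectiveP/leq_card; rewrite !card_ord ltnn.
wlog lt_ij : i j nij fij / (i < j)%N => [wl|].
  case: (ssrnat.ltngtP i j) => [ij|ji|/val_inj E]; last by rewrite E eqxx in nij.
    exact: (wl i j).
  by apply: (wl j i) => //; rewrite eq_sym.
have lt_j := ltn_ord j.
have E : ((i * k) %% n * C %/ n = (j * k) %% n * C %/ n)%N := congr1 val fij.
have Di := divn_eq ((i * k) %% n * C) n; have Dj := divn_eq ((j * k) %% n * C) n.
have ri := ltn_pmod ((i * k) %% n * C) n0; have rj := ltn_pmod ((j * k) %% n * C) n0.
have Ei := divn_eq (i * k) n; have Ej := divn_eq (j * k) n.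
have Dk : (j * k = i * k + (j - i) * k)%N by rewrite -mulnDl subnKC // ltnW.
exists (j - i)%N.
have a0 : (0 < j - i <= C)%N by clear -lt_ij lt_j; lia.
move: Di Dj ri rj Ei Ej; rewrite E.
move: ((j * k) %% n * C %/ n)%N ((i * k) %% n * C %% n)%N ((j * k) %% n * C %% n)%N => q r1 r2.
move: ((i * k) %% n)%N ((j * k) %% n)%N ((i * k) %/ n)%N ((j * k) %/ n)%N => x y u v.
move=> Di Dj ri rj Ei Ej.
case: (leqP x y) => xy.
  exists (y - x)%N; split=> //; first by clear -Di Dj ri rj xy; nia.
  left; have : ((j - i) * k + u * n = (y - x) + v * n)%N by clear -Dk Ei Ej xy; lia.
  move/(congr1 (fun t => t %% n)%N).
  by rewrite ![(_ + _ * n)%N]addnC !modnMDl.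
exists (x - y)%N; split=> //; first by clear -Di Dj ri rj xy; nia.
right; have : ((j - i) * k + (x - y) + u * n = 0 + v * n)%N by clear -Dk Ei Ej xy; lia.
move/(congr1 (fun t => t %% n)%N).
by rewrite ![(_ + _ * n)%N]addnC !modnMDl.
Qed.

(** * Calculus in the ideals (F, m, X^n - 1) *)

Lemma Xn_sub1_dvd_XnM (n k : nat) :
  exists C : {poly int}, 'X^(n * k) - 1 = C * ('X^n - 1).
Proof.
by exists (\sum_(i < k) ('X^n) ^+ i); rewrite mulrC exprM subrX1.
Qed.

Section Ideal.
Variables (F : {poly int}) (m n : nat).
Local Notation I := (in_ideal F m n).

Lemma in_ideal0 : I 0.
Proof. by exists 0, 0, 0; rewrite !mul0r !addr0. Qed.

Lemma in_idealD P Q : I P -> I Q -> I (P + Q).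
Proof.
move=> [A [B [C ->]]] [A' [B' [C' ->]]].
by exists (A + A'), (B + B'), (C + C'); ring.
Qed.

Lemma in_idealM P Q : I Q -> I (P * Q).
Proof. by move=> [A [B [C ->]]]; exists (P * A), (P * B), (P * C); ring. Qed.

Lemma in_ideal_Xn1 C : I (C * ('X^n - 1)).
Proof. by exists 0, 0, C; rewrite !mul0r !add0r. Qed.

Lemma in_ideal_subr P Q : I (P - Q) -> I Q -> I P.
Proof. by move=> IPQ IQ; rewrite -(subrK Q P); apply: in_idealD. Qed.

Lemma in_ideal_Xmod a b : (a = b %[mod n])%N -> I ('X^a - 'X^b).
Proof.
wlog le_ba : a b / (b <= a)%N => [wl|] ab.
  case: (ssrnat.leqP b a) => [ba|/ltnW ba]; first exact: wl.
  rewrite -[_ - _]opprB -mulN1r; apply: in_idealM; exact: wl.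
have /dvdnP[k Dk] : (n %| a - b)%N by rewrite -eqn_mod_dvd //; apply/eqP.
have -> : 'X^a - 'X^b = 'X^b * ('X^(n * k) - 1) :> {poly int}.
  by rewrite mulrBr mulr1 -exprD mulnC -Dk subnKC.
by apply: in_idealM; have [C ->] := Xn_sub1_dvd_XnM n k; apply: in_ideal_Xn1.
Qed.

Lemma in_ideal_sum (s : nat) (f : nat -> {poly int}) :
  (forall i, (i < s)%N -> I (f i)) -> I (\sum_(i < s) f i).
Proof.
by move=> If; elim/big_ind: _ => [|P Q|i _]; [apply: in_ideal0|apply: in_idealD|apply: If].
Qed.

Lemma in_ideal_comp_mod (G : {poly int}) a b : (a = b %[mod n])%N ->
  I ((G \Po 'X^a) - (G \Po 'X^b)).
Proof.
move=> ab; have -> : (G \Po 'X^a) - (G \Po 'X^b)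
    = \sum_(i < size G) (G`_i *: 'X^a ^+ i - G`_i *: 'X^b ^+ i).
  by rewrite sumrB -!comp_polyE.
apply: (@in_ideal_sum _ (fun i => G`_i *: 'X^a ^+ i - G`_i *: 'X^b ^+ i)) => i _.
rewrite -!exprM -scalerBr -mul_polyC; apply/in_idealM/in_ideal_Xmod.
by rewrite -modnMml ab modnMml.
Qed.

End Ideal.

(** The reciprocal polynomial [X^e G(1/X)], with [e] the degree of [G]. *)
Definition rev_poly (G : {poly int}) : {poly int} :=
  \poly_(i < size G) G`_((size G).-1 - i).

Lemma rev_poly_neq0 G : G != 0 -> rev_poly G != 0.
Proof.
move=> nzG; apply: contraNneq (nzG) => E; have : (rev_poly G)`_0 = 0 by rewrite E coef0.
by rewrite coef_poly size_poly_gt0 nzG subn0 => /eqP; rewrite lead_coef_eq0.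
Qed.

(** Modulo [X^n - 1] the powers [X^k] and [X^k'] are inverse to each other, so the reversed [G] at
    [X^k'] is [X^(k' e)] times [G(X^k)]. This treats the sign [-b] without negative exponents. *)
Lemma in_ideal_rev (F G : {poly int}) m n k k' : (k + k' = 0 %[mod n])%N ->
  in_ideal F m n (G \Po 'X^k) -> in_ideal F m n (rev_poly G \Po 'X^k').
Proof.
move=> kk' IG; have [->|nzG] := eqVneq G 0.
  by rewrite /rev_poly size_poly0 poly_def big_ord0 comp_poly0; apply: in_ideal0.
pose e := (size G).-1; have De : size G = e.+1 by rewrite prednK // size_poly_gt0.
pose R : {poly int} := \sum_(i < e.+1) G`_i *: 'X^(k' * (e - i)).
have DR : rev_poly G \Po 'X^k' = R.
  rewrite /rev_poly De poly_def -/e raddf_sum /= /R (reindex_inj rev_ord_inj) /=.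
  apply: eq_bigr => i _; rewrite comp_polyZ comp_Xn_poly -exprM subSS.
  by rewrite -/e subKn // -ltnS.
have IRG : in_ideal F m n (R - 'X^(k' * e) * (G \Po 'X^k)).
  rewrite comp_polyE De mulr_sumr -sumrB.
  apply: (@in_ideal_sum _ _ _ _ (fun i =>
    G`_i *: 'X^(k' * (e - i)) - 'X^(k' * e) * (G`_i *: 'X^k ^+ i))).
  move=> i; rewrite ltnS => le_ie.
  rewrite -exprM -scalerAr -exprD -scalerBr -mul_polyC; apply/in_idealM/in_ideal_Xmod.
  have -> : (k' * e + k * i = k' * (e - i) + i * (k + k'))%N by clear -le_ie; nia.
  by rewrite -modnDmr -(modnMmr i) kk' mod0n muln0 mod0n addn0.
by rewrite DR; apply: in_ideal_subr IRG _; apply: in_idealM.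
Qed.

(** The powers of [a] are pairwise distinct, so each entry of [rs] is reached by at most one
    exponent. *)
Lemma expr_bounded_of_mem (a : algC) (rs : seq algC) :
  a != 0 -> (forall n, (0 < n)%N -> a ^+ n != 1) ->
  exists B, forall b, a ^+ b \in rs -> (b <= B)%N.
Proof.
move=> nza nua.
have inj b c : a ^+ b = a ^+ c -> b = c.
  wlog le_bc : b c / (b <= c)%N => [wl E|E].
    by case: (ssrnat.leqP b c) => [|/ltnW] le; [exact: wl|apply/esym/wl].
  have [//|lt_bc] := leqP c b; first by move=> cb; apply/eqP; rewrite eqn_leq le_bc.
  have := nua (c - b)%N; rewrite subn_gt0 lt_bc => /(_ isT).
  by rewrite expfB // -E divff ?expf_neq0 ?eqxx.
elim: rs => [|r rs [B BP]]; first by exists 0%N.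
have [[b0 Db0]|nb] := EM (exists b0, a ^+ b0 = r).
  exists (maxn B b0) => b; rewrite inE -Db0 leq_max => /orP[/eqP/inj->|/BP->] //.
  by rewrite leqnn orbT.
exists B => b; rewrite inE => /orP[/eqP E|/BP //].
by case: nb; exists b.
Qed.

(** * Rationality of mu *)

Definition l1norm (Q : {poly int}) (e : nat) : algC := \sum_(i < e.+1) `|(Q`_i)%:~R|.

Lemma l1norm_ge0 Q e : 0 <= l1norm Q e.
Proof. by apply: sumr_ge0. Qed.

(** One pair of constants serves all [k] up to [C]. [B1] exists because each [Q] has finitely many
    roots; it bounds [b] once [Q(a^b) = 0] is known. *)
Lemma exists_bounded_multiples (G : {poly int}) (a : algC) (C e : nat) :
  G != 0 -> (size G <= e.+1)%N -> a != 0 -> (forall n, (0 < n)%N -> a ^+ n != 1) ->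
  exists (B0 : algC) (B1 : nat), 0 <= B0 /\ forall k, (0 < k <= C)%N ->
    exists Q : {poly int}, [/\ (size Q <= e.+1)%N, exists R, Q \Po 'X^k = R * G,
      l1norm Q e <= B0 & forall b, (ZtoC Q).[a ^+ b] = 0 -> (b <= B1)%N].
Proof.
move=> nzG sG nza nua; elim: C => [|C [B0 [B1 [B00 IH]]]].
  by exists 0, 0%N; split=> // k; case: k.
have [Q [nzQ sQ QP]] := exists_comp_Xn_multiple C.+1 nzG.
have [rs Drs] := closed_field_poly_normal (ZtoC Q).
have [B BP] := expr_bounded_of_mem rs nza nua.
exists (B0 + l1norm Q e), (maxn B1 B); split; first by rewrite addr_ge0 ?l1norm_ge0.
move=> k; case: (ltngtP k C.+1) => [kC /andP[k0 _]|kC|-> _].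
- have [|Q' [? ? nQ' bQ']] := IH k; first by rewrite k0 -ltnS.
  exists Q'; split=> //; first by rewrite (le_trans nQ') // lerDl l1norm_ge0.
  by move=> b /bQ'; rewrite leq_max => ->.
- by rewrite andbF.
exists Q; split=> //; first exact: leq_trans sG.
  by rewrite lerDr.
move=> b /eqP; rewrite -[_ == 0]/(root _ _) Drs rootZ; last first.
  by rewrite lead_coef_eq0 ZtoC_eq0.
by rewrite root_prod_XsubC => /BP; rewrite leq_max orbC => ->.
Qed.

Lemma in_ideal_comp_multiple (F G Q : {poly int}) m n k a b :
  (exists R, Q \Po 'X^a = R * G) -> (a * k = b %[mod n])%N ->
  in_ideal F m n (G \Po 'X^k) -> in_ideal F m n (Q \Po 'X^b).
Proof.
move=> [R DQ] akb IG.
apply: (@in_ideal_subr _ _ _ _ (Q \Po 'X^(a * k))).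
  exact/in_ideal_comp_mod/esym.
have -> : Q \Po 'X^(a * k) = (R \Po 'X^k) * (G \Po 'X^k).
  by rewrite -comp_polyM -DQ -comp_polyA comp_Xn_poly -exprM mulnC.
exact: in_idealM.
Qed.

Definition congr_pm (s : bool) (n x b : nat) : bool :=
  if s then x == b %[mod n] else x + b == 0 %[mod n].

(** [C] and [B] do not depend on [N]. For each [N] the vanishing lemma fixes [n], the pigeonhole
    then gives [c] and [b], and [Q(a^b) = 0] bounds [b]. *)
Lemma bounded_congruences (F G : {poly int}) (k : nat -> nat) (a : algC) :
  G != 0 -> root (ZtoC F) a -> a != 0 -> (forall n, (0 < n)%N -> a ^+ n != 1) ->
  (forall m n, (1 < m)%N -> (1 < n)%N -> in_ideal F m n (G \Po 'X^(k n))) ->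
  exists C B, forall N, (0 < N)%N -> exists n c b s,
    [/\ (1 < n)%N, (N %| n)%N, (0 < c <= C)%N, (b <= B)%N & congr_pm s n (c * k n) b].
Proof.
move=> nzG Fa nza nua IG.
pose e := (size G).-1; have De : size G = e.+1 by rewrite prednK // size_poly_gt0.
(* From [b * C < n] follows [2 * (b * e) <= n], the degree condition for the vanishing of [Q(X^b)]
   at [a]. *)
pose C := (2 * e).+1.
have sG : (size G <= e.+1)%N by rewrite De.
have sG' : (size (rev_poly G) <= e.+1)%N by rewrite -De size_poly.
have [B0 [B1 [B00 BP]]] := @exists_bounded_multiples G a C e nzG sG nza nua.
have [B0' [B1' [B00' BP']]] :=
  @exists_bounded_multiples _ a C e (rev_poly_neq0 nzG) sG' nza nua.
exists C, (maxn B1 B1') => N N0.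
(* The sum of both bounds is used because [n] is chosen before the sign is known. *)
have [n [n1 Nn nP]] := in_ideal_vanish Fa nza nua N0 (addr_ge0 B00 B00').
have n0 : (0 < n)%N := ltnW n1.
have [c [b [cC bC E]]] := thue_pigeonhole (k n) n0 (isT : 0 < C)%N.
have vanish (Q : {poly int}) : (size Q <= e.+1)%N -> l1norm Q e <= B0 + B0' ->
    (forall m, (1 < m)%N -> in_ideal F m n (Q \Po 'X^b)) -> (ZtoC Q).[a ^+ b] = 0.
  move=> sQ nQ IQ.
  have horn (x : algC) : (ZtoC (Q \Po 'X^b)).[x] = (ZtoC Q).[x ^+ b].
    by rewrite map_comp_poly map_polyXn horner_comp hornerXn.
  rewrite -horn; apply/eqP/(nP _ (b * e)%N) => //.
  - apply: leq_trans (size_comp_poly_leq _ _) _; rewrite size_polyXn /= ltnS.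
    have sQ' : ((size Q).-1 <= e)%N by case: (size Q) sQ.
    by rewrite mulnC leq_mul2l sQ' orbT.
  - by clear -bC; rewrite /C in bC; nia.
  move=> x; rewrite horn; apply: le_trans (horner_norm_le _ sQ) _.
  rewrite max1X -exprM ler_wpM2r // exprn_ge0 // ltW // max1_gt0 //.
exists n, c, b.
case: E => E.
  exists true; split=> //; last by apply/eqP.
  have [Q [sQ QR nQ bQ]] := BP c cC; rewrite leq_max bQ // vanish //.
    by rewrite (le_trans nQ) // lerDl.
  by move=> m m1; apply: in_ideal_comp_multiple QR E (IG m n m1 n1).
exists false; split=> //; last by apply/eqP.
have [Q [sQ QR nQ bQ]] := BP' c cC; rewrite leq_max orbC bQ // vanish //.
  by rewrite (le_trans nQ) // lerDr.
(* [k'] represents [- k n] modulo [n], so that [c * k'] is congruent to [b]. *)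
pose k' := (n - k n %% n)%N.
have lt_k : (k n %% n < n)%N by rewrite ltn_mod.
have kk' : (k n + k' = 0 %[mod n])%N.
  by rewrite -modnDml /k' subnKC ?(ltnW lt_k) // modnn mod0n.
move=> m m1; apply: in_ideal_comp_multiple QR _ (in_ideal_rev kk' (IG m n m1 n1)).
have : (c * k n + c * k' = c * k n + b %[mod n])%N.
  by rewrite E -mulnDr -modnMmr kk' mod0n muln0 mod0n.
by move/eqP; rewrite eqn_modDl => /eqP.
Qed.

(** Only finitely many triples [(c, b, s)] occur. If each failed at some modulus [N t], an [n]
    divisible by the product of these moduli would contradict the bounded congruences. *)
Lemma exists_integer_ratio (F G : {poly int}) (k : nat -> nat) (a : algC) :
  G != 0 -> root (ZtoC F) a -> a != 0 -> (forall n, (0 < n)%N -> a ^+ n != 1) ->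
  (forall m n, (1 < m)%N -> (1 < n)%N -> in_ideal F m n (G \Po 'X^(k n))) ->
  (forall N n, (1 < N)%N -> (1 < n)%N -> (N %| n)%N -> k n = k N %[mod N]) ->
  exists c b s, (0 < c)%N /\ forall N, (1 < N)%N -> congr_pm s N (c * k N) b.
Proof.
move=> nzG Fa nza nua IG compat.
have [C [B CBP]] := bounded_congruences nzG Fa nza nua IG.
apply: contrapT => no.
pose T := ('I_C * 'I_B.+1 * bool)%type.
have [t|N NP] := @fin_all_exists T (fun=> nat) (fun t N =>
    (1 < N)%N /\ ~~ congr_pm t.2 N (t.1.1.+1 * k N) t.1.2).
  apply: contrapT => no2; apply: no; exists t.1.1.+1, t.1.2, t.2; split=> // N N1.
  by apply/negPn/negP => nN; apply: no2; exists N.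
have [|n [c [b [s [n1 Nn /andP[c0 cC] bB E]]]]] := CBP (\prod_(t : T) N t)%N.
  by rewrite prodn_gt0 // => t; have [/ltnW] := NP t.
have cC' : (c.-1 < C)%N by rewrite prednK.
pose t : T := ((Ordinal cC', Ordinal (bB : (b < B.+1)%N)), s).
have [N1 /negP] := NP t; apply; rewrite /= prednK //.
have Ntn : (N t %| n)%N by apply: dvdn_trans Nn; rewrite (bigD1 t) //= dvdn_mulr.
have kE := compat _ _ N1 n1 Ntn.
have red x y : x = y %[mod n] -> x = y %[mod N t].
  by move=> xy; rewrite -(modn_dvdm x Ntn) xy modn_dvdm.
move: E; rewrite /congr_pm; case: (s) => /eqP/red E; apply/eqP.
  by rewrite -modnMmr -kE modnMmr.
by rewrite -modnDml -modnMmr -kE modnMmr modnDml.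
Qed.

(** * Closedness of principal ideals *)

(** Modulo [m], [H] is a multiple of the monic [P] and has smaller degree, so it vanishes. *)
Lemma monic_reduction (P H B : {poly int}) (m : nat) : P \is monic ->
  (exists A : {poly int}, H = A * P + B * m%:R) -> (size H < size P)%N ->
  exists K : {poly int}, H = K * m%:R.
Proof.
move=> Pmon [A DH] sH; pose K := Pdiv.Ring.rmodp B P; exists K.
have sK : (size (K * m%:R)%R < size P)%N.
  rewrite mulr_natr -scaler_nat (leq_ltn_trans (size_scale_leq _ _)) //.
  by rewrite Pdiv.Ring.ltn_rmodpN0 // monic_neq0.
have E : H - K * m%:R = (A + Pdiv.Ring.rdivp B P * m%:R) * P.
  rewrite DH {1}(Pdiv.RingMonic.rdivp_eq Pmon B) -/K; ring.
have [A0|nzA] := eqVneq (A + Pdiv.Ring.rdivp B P * m%:R) 0.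
  by apply/eqP; rewrite -subr_eq0 E A0 mul0r.
have : (size ((A + Pdiv.Ring.rdivp B P * m%:R) * P)%R < size P)%N.
  by rewrite -E (leq_ltn_trans (size_polyD _ _)) // size_polyN gtn_max sH.
rewrite size_Mmonic //; have := nzA; rewrite -size_poly_gt0.
by case: (size (A + _)) => // t _; rewrite addSn /= ltnNge leq_addl.
Qed.

(** For [n] above the degree of [H], reducing modulo [X^n - 1] leaves the coefficients of [H]
    unchanged. *)
Lemma in_ideal_contents (F H : {poly int}) (m : nat) :
  (exists K : {poly int}, F = K * m%:R) -> (1 < m)%N ->
  (forall n, (1 < n)%N -> in_ideal F m n H) -> exists K : {poly int}, H = K * m%:R.
Proof.
move=> [K DF] m1 IH.
have [n n1 sHn] : exists2 n, (1 < n)%N & (size H < n.+1)%N.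
  by exists (size H).+2 => //; rewrite !ltnS leqW.
have [A [B [C DH]]] := IH n n1.
apply: (@monic_reduction ('X^n - 1) H (A * K + B)).
- exact/monic_Xn_sub_1/ltnW.
- by exists C; rewrite DH DF; ring.
by rewrite size_Xn_sub1_int // ltnW.
Qed.

(** A coefficient [c] is divisible by [q] to the power [|c|], which exceeds [|c|]. *)
Lemma poly_eq0_of_dvdn (H : {poly int}) (q : nat) : (1 < q)%N ->
  (forall i, exists K : {poly int}, H = K * (q ^ i)%N%:R) -> H = 0.
Proof.
move=> q1 HK; apply/polyP=> j; rewrite coef0; set c : int := H`_j.
have [K DK] := HK `|c|%N.
have dc : (q ^ `|c| %| `|c|)%N.
  rewrite -[X in (X %| _)%N]/(`|(q ^ `|c|)%N : int|)%N -dvdzE.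
  have Dc : c = K`_j * (q ^ `|c|)%N by rewrite {1}/c DK mulr_natr coefMn -mulr_natr natz.
  by rewrite [X in (_ %| X)%Z]Dc dvdz_mull.
apply/eqP; rewrite -absz_eq0; apply: contraTT (ltn_expl `|c|%N q1) => nz.
by rewrite -leqNgt dvdn_leq // lt0n.
Qed.

Definition in_ideal2 (F : {poly int}) (m : nat) (H : {poly int}) : Prop :=
  exists A B : {poly int}, H = A * F + B * m%:R.

(** [u] inverts the leading coefficient modulo [m]; a multiple of [m] times [X^d] added to [u F]
    makes the leading coefficient exactly 1. *)
Lemma exists_monic_mod (F : {poly int}) (m : nat) : F != 0 -> coprimez m (lead_coef F) ->
  exists P : {poly int}, [/\ P \is monic, size P = size F, in_ideal2 F m P & in_ideal2 P m F].
Proof.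
move=> nzF /coprimezP[[x u] /= E]; pose d := (size F).-1.
have Dd : size F = d.+1 by rewrite prednK // size_poly_gt0.
have mP (c : int) (Q : {poly int}) : (c * m) *: Q = c *: Q * m%:R.
  by rewrite mulr_natr -scaler_nat scalerA natz mulrC.
pose P := u *: F + (x * m) *: 'X^d; exists P.
have Pd : P`_d = 1.
  by rewrite coefD !coefZ coefXn eqxx mulr1 -[F`_d]/(lead_coef F) addrC.
have sP : size P = d.+1.
  apply/eqP; rewrite eqn_leq; apply/andP; split; last first.
    by rewrite ltnNge; apply/negP => /leq_sizeP/(_ d (leqnn d)); rewrite Pd.
  apply: leq_trans (size_polyD _ _) _; rewrite geq_max -{1}Dd size_scale_leq /=.
  by apply: leq_trans (size_scale_leq _ _) _; rewrite size_polyXn.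
split.
- by rewrite monicE lead_coefE sP /= Pd.
- by rewrite sP Dd.
- by exists u%:P, (x *: 'X^d); rewrite mul_polyC /P mP.
exists (lead_coef F)%:P, (x *: F - (lead_coef F * x) *: 'X^d).
have -> : F = (x * m + u * lead_coef F) *: F by rewrite E scale1r.
rewrite E scale1r /P mul_polyC scalerDr !scalerA mulrBl -!mP -[in LHS](scale1r F) -E scalerDl.
rewrite [lead_coef F * (x * m)]mulrA [lead_coef F * u]mulrC; ring.
Qed.

(** The invertible leading coefficient makes [(Z/m)[X]/(F)] finite, and the invertible constant term
    makes [X] a unit there; hence [X] has finite order. *)
Lemma Xn_sub1_in_coprime_ideal (F : {poly int}) (m : nat) : (1 < m)%N -> F != 0 ->
  coprimez m (lead_coef F) -> coprimez m F`_0 ->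
  exists2 n, (1 < n)%N & in_ideal2 F m ('X^n - 1).
Proof.
move=> m1 nzF clc c0; have [P [Pmon sP [A0 [B0 DP]] _]] := exists_monic_mod nzF clc.
pose d := size F.
pose f (j : nat) : {ffun 'I_d -> 'I_m.-1.+1} :=
  [ffun i : 'I_d => inord `|((Pdiv.Ring.rmodp 'X^j P)`_i %% m)%Z|%N].
pose g (j : 'I_(#|{: {ffun 'I_d -> 'I_m.-1.+1}}|).+1) := f j.
have /injectivePn[j1 [j2 nj gj]] : ~~ injectiveb g.
  by apply/negP => /injectiveP/leq_card; rewrite card_ord ltnn.
wlog lt_j : j1 j2 nj gj / (j1 < j2)%N => [wl|].
  case: (ssrnat.ltngtP j1 j2) => [ij|ji|/val_inj E]; first exact: wl ij.
    by apply: (wl j2 j1) => //; rewrite eq_sym.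
  by rewrite E eqxx in nj.
have m0 : (m : int) != 0 by rewrite eqz_nat -lt0n ltnW.
have coefE i : ((Pdiv.Ring.rmodp 'X^j1 P)`_i == (Pdiv.Ring.rmodp 'X^j2 P)`_i %[mod m])%Z.
  have sm (j : nat) : (size (Pdiv.Ring.rmodp 'X^j P) <= d)%N.
    by rewrite ltnW // /d -sP Pdiv.Ring.ltn_rmodpN0 // monic_neq0.
  have [lt_i|le_i] := ltnP i d; last by rewrite !nth_default ?(leq_trans (sm _)).
  have := congr1 (fun h : {ffun _ -> _} => val (h (Ordinal lt_i))) gj.
  rewrite /g /f !ffunE /=.
  have lt_m (z : int) : (`|(z %% m)%Z| < m.-1.+1)%N.
    rewrite prednK ?(ltnW m1) // -ltz_nat gez0_abs ?modz_ge0 //.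
    by rewrite ltz_pmod // ltz_nat ltnW.
  rewrite !inordK // => /eqP; rewrite -eqz_nat !gez0_abs ?modz_ge0 //.
have [K DK] : exists K : {poly int},
    Pdiv.Ring.rmodp 'X^j2 P - Pdiv.Ring.rmodp 'X^j1 P = K * m%:R.
  have /polyOver_dvdzP[K DK] :
      Pdiv.Ring.rmodp 'X^j2 P - Pdiv.Ring.rmodp 'X^j1 P \is a polyOver (dvdz m).
    by apply/polyOverP => i; rewrite coefB -eqz_mod_dvd eq_sym.
  by exists K; rewrite DK mulr_natr -scaler_nat natz.
pose n := (j2 - j1)%N.
have [y [v [E0 [F1 DF]]]] : exists y v : int, y * m + v * F`_0 = 1 /\
    exists F1, F = F1 * 'X + (F`_0)%:P.
  have /coprimezP[[y v] /= E] := c0; exists y, v; split=> //.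
  elim/poly_ind: (F) => [|F1 c _]; first by exists 0; rewrite mul0r add0r coef0.
  by exists F1; rewrite coefD coefMX coefC /= add0r.
have unX (Q : {poly int}) : in_ideal2 F m ('X * Q) -> in_ideal2 F m Q.
  move=> [A [B DQ]]; exists (v%:P * Q - v%:P * F1 * A), (y%:P * Q - v%:P * F1 * B).
  have one : 1 = y%:P * m%:R + v%:P * (F`_0)%:P :> {poly int}.
    by rewrite -polyC_natr natz -!polyCM -polyCD E0.
  have DF0 : (F`_0)%:P = F - F1 * 'X by rewrite {2}DF; ring.
  have DQ' : Q = y%:P * Q * m%:R + v%:P * Q * F - v%:P * F1 * ('X * Q).
    by rewrite -[LHS]mul1r [X in X * Q = _]one DF0; ring.
  by rewrite {1}DQ' DQ; ring.
have In : in_ideal2 F m ('X^n - 1).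
  have : in_ideal2 F m ('X^j1 * ('X^n - 1)).
    have -> : 'X^j1 * ('X^n - 1) = 'X^j2 - 'X^j1 :> {poly int}.
      by rewrite mulrBr mulr1 -exprD subnKC // ltnW.
    pose D := Pdiv.Ring.rdivp 'X^j2 P - Pdiv.Ring.rdivp 'X^j1 P.
    exists (D * A0), (D * B0 + K).
    rewrite {1}(Pdiv.RingMonic.rdivp_eq Pmon 'X^j2) {1}(Pdiv.RingMonic.rdivp_eq Pmon 'X^j1).
    have -> : D * A0 * F + (D * B0 + K) * m%:R = D * P + K * m%:R by rewrite DP; ring.
    by rewrite -DK /D; ring.
  elim: (nat_of_ord j1) => [|j IH]; first by rewrite expr0 mul1r.
  by rewrite exprS -mulrA => /unX.
(* Doubling makes the exponent exceed 1 even when [n = 1]. *)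
exists (2 * n)%N; first by rewrite /n; lia.
have [A [B DAB]] := In; exists (('X^n + 1) * A), (('X^n + 1) * B).
have -> : 'X^(2 * n) - 1 = ('X^n + 1) * ('X^n - 1) :> {poly int}.
  by rewrite mulnC exprM; ring.
by rewrite DAB; ring.
Qed.

(** For a prime [q] not dividing the extreme coefficients of [F], some [X^n - 1] lies in the ideal
    of [F] modulo each power of [q]. So every power of [q] divides the remainder of [H] by [F],
    which is 0. *)
Lemma dvdp_of_in_ideal (F H : {poly int}) : F`_0 != 0 ->
  (forall m n, (1 < m)%N -> (1 < n)%N -> in_ideal F m n H) -> F %| H.
Proof.
move=> F0 IH; have nzF : F != 0 by apply: contraNneq F0 => ->; rewrite coef0.
have [q lt_q q_pr] := prime_above (`|lead_coef F| + `|(F`_0)%R|).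
have cop (z : int) (i : nat) : z != 0 ->
    (`|z| <= `|lead_coef F| + `|(F`_0)%R|)%N -> coprimez (q ^ i)%N z.
  move=> nz le; rewrite coprimezE /= coprimeXl // prime_coprime //.
  apply/negP => /dvdn_leq; rewrite absz_gt0 nz => /(_ isT).
  by rewrite leqNgt (leq_ltn_trans le).
rewrite /dvdp; apply/eqP; apply: (@poly_eq0_of_dvdn _ q); first exact: prime_gt1.
move=> i; pose m := (q ^ i.+1)%N.
have m1 : (1 < m)%N by rewrite -[1%N](expn0 q) ltn_exp2l ?prime_gt1.
have clc : coprimez m (lead_coef F) by rewrite cop ?lead_coef_eq0 ?leq_addr.
have c0 : coprimez m F`_0 by rewrite cop ?leq_addl.
have [n n1 [A1 [B1 DX]]] := Xn_sub1_in_coprime_ideal m1 nzF clc c0.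
have [P [Pmon sP _ [A2 [B2 DF]]]] := exists_monic_mod nzF clc.
have [A [B [C DH]]] := IH m n m1 n1.
(* Pseudo-division over the integers divides [l *: H], not [H], by [F]. *)
pose l := lead_coef F ^+ scalp H F.
have [K DK] : exists K : {poly int}, H %% F = K * m%:R.
  pose T := l *: A + l *: C * A1 - H %/ F; pose U := l *: B + l *: C * B1.
  apply: (@monic_reduction P _ (T * B2 + U)) => //; last by rewrite sP ltn_modpN0.
  exists (T * A2).
  have -> : T * A2 * P + (T * B2 + U) * m%:R = T * F + U * m%:R by rewrite {1}DF; ring.
  have -> : H %% F = l *: H - H %/ F * F by rewrite Pdiv.Idomain.divp_eq; ring.
  have -> : l *: H = l *: A * F + l *: B * m%:R + l *: C * ('X^n - 1).
    by rewrite {1}DH !scalerDr !scalerAl.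
  by rewrite DX /T /U; ring.
exists (K * q%:R); rewrite DK /m expnSr natrM; ring.
Qed.

(** Mutual divisibility over the rationals gives equal primitive parts; the contents divide each
    other, and they carry the sign. *)
Lemma in_ideal_antisym (F G : {poly int}) : F`_0 != 0 -> G`_0 != 0 ->
  (forall m n, (1 < m)%N -> (1 < n)%N -> in_ideal F m n G) ->
  (forall m n, (1 < m)%N -> (1 < n)%N -> in_ideal G m n F) ->
  F = G \/ F = - G.
Proof.
move=> F0 G0 IG IF.
have zcdvd (P Q : {poly int}) : P != 0 ->
    (forall m n, (1 < m)%N -> (1 < n)%N -> in_ideal P m n Q) -> (zcontents P %| zcontents Q)%Z.
  move=> nzP IQ; have nzc : (0 < `|zcontents P|)%N by rewrite absz_gt0 zcontents_eq0.
  have [c1|c1] := leqP `|zcontents P|%N 1.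
    by rewrite dvdzE (_ : `|_|%N = 1%N) ?dvd1n //; apply/eqP; rewrite eqn_leq c1.
  have [|K DQ] := @in_ideal_contents P Q _ _ c1 (fun n => IQ _ n c1).
    exists (Num.sg (zcontents P) *: zprimitive P).
    rewrite {1}[P]zpolyEprim mulr_natr -scaler_nat scalerA natz abszE mulrC.
    by rewrite -numEsg.
  rewrite dvdz_contents; apply/polyOverP => i.
  rewrite DQ mulr_natr coefMn -mulr_natr natz; apply: dvdz_mull.
  by rewrite dvdzE absz_nat.
have nzF : F != 0 by apply: contraNneq F0 => ->; rewrite coef0.
have nzG : G != 0 by apply: contraNneq G0 => ->; rewrite coef0.
have /eqpP[[c1 c2] /= /andP[nz1 nz2] E] : F %= G.
  by rewrite /eqp !dvdp_of_in_ideal.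
have EP : zprimitive F = zprimitive G by rewrite -(zprimitiveZ F nz1) E zprimitiveZ.
have zFG := zcdvd F G nzF IG; have zGF := zcdvd G F nzG IF.
have : `|zcontents F|%N = `|zcontents G|%N.
  by apply/eqP; rewrite eqn_dvd -!dvdzE zFG.
move/eqP; rewrite -eqz_nat !abszE eqr_norm2 => /orP[/eqP Ec|/eqP Ec].
  by left; rewrite [LHS]zpolyEprim [RHS]zpolyEprim EP Ec.
by right; rewrite [LHS]zpolyEprim [X in - X]zpolyEprim EP Ec scaleNr.
Qed.

(** * Finite levels of the completed group ring *)

Section GroupRingTerms.
Variables (R : comNzRingType) (K : zmodType).
Implicit Types (a b : R) (k l : K).

Lemma grptermM a b k l : (grpterm a k : grpring R K) * grpterm b l = grpterm (a * b) (k + l).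
Proof. exact: grpmulUU. Qed.

Lemma grpterm1 : grpterm 1 0 = 1 :> grpring R K.
Proof. by []. Qed.

Lemma grpterm_mulrzK k (j : int) :
  grpterm 1 (k *~ j) * grpterm 1 (k *~ (- j)) = 1 :> grpring R K.
Proof. by rewrite grptermM mulr1 -mulrzDr subrr mulr0z. Qed.

Lemma grptermX k j : (grpterm 1 k : grpring R K) ^+ j = grpterm 1 (k *+ j).
Proof.
elim: j => [|j IH]; first by rewrite expr0 mulr0n grpterm1.
by rewrite exprS IH grptermM mulr1 mulrS.
Qed.

Lemma grpterm_int (z : int) k : grpterm z%:~R k = z%:~R * grpterm 1 k :> grpring R K.
Proof.
have nat_case (n : nat) : grpterm n%:R k = n%:R * grpterm 1 k :> grpring R K.
  elim: n => [|n IH]; first by rewrite mul0r grpterm0.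
  by rewrite -!natr1 grptermD IH mulrDl mul1r.
case: z => n; first exact: nat_case.
rewrite NegzE !mulrNz mulNr -nat_case.
by apply/eqP; rewrite -addr_eq0 -grptermD addNr grpterm0.
Qed.

Definition geval k (P : {poly int}) : grpring R K := (map_poly intr P).[grpterm 1 k].

Lemma geval_comp_Xn k j P : geval k (P \Po 'X^j) = geval (k *+ j) P.
Proof. by rewrite /geval map_comp_poly map_polyXn horner_comp hornerXn grptermX. Qed.

Lemma gevalM k P Q : geval k (P * Q) = geval k P * geval k Q.
Proof. by rewrite /geval rmorphM hornerM. Qed.

Lemma gevalB k P Q : geval k (P - Q) = geval k P - geval k Q.
Proof. by rewrite /geval rmorphB /= !hornerE. Qed.

Lemma gevalD k P Q : geval k (P + Q) = geval k P + geval k Q.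
Proof. by rewrite /geval rmorphD /= !hornerE. Qed.

Lemma gevalZXn k (z : int) j : geval k (z *: 'X^j) = grpterm z%:~R (k *+ j).
Proof.
rewrite /geval -mul_polyC rmorphM /= map_polyC map_polyXn /= !hornerE.
by rewrite grptermX -grpterm_int.
Qed.

Lemma geval0 k : geval k 0 = 0.
Proof. by rewrite /geval rmorph0 horner0. Qed.

Lemma geval_sum k (I : Type) (r : seq I) (F : I -> {poly int}) :
  geval k (\sum_(i <- r) F i) = \sum_(i <- r) geval k (F i).
Proof. exact: (big_morph (geval k) (gevalD k) (geval0 k)). Qed.

End GroupRingTerms.

Arguments geval {R K} k P.

Section FiniteLevel.
Variable i : nat * nat.
Let m := i.1.+2.
Let n := i.2.+2.

Lemma geval_surj (x : ZZmod i) : exists P, x = geval 1 P.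
Proof.
rewrite (grpringE x); elim/big_ind: _ => [|y z [P ->] [Q ->]|k _].
- by exists 0; rewrite geval0.
- by exists (P + Q); rewrite gevalD.
exists ((x@_k : 'Z_(i.1.+2))%:Z *: 'X^(k : 'Z_(i.2.+2))).
by rewrite gevalZXn natr_Zp -[X in grpterm X k](natr_Zp).
Qed.

Lemma Zmod_natr_eq0 (l j : nat) : (j%:R == 0 :> 'Z_(l.+2)) = (l.+2 %| j)%N.
Proof. by rewrite Zp_nat -val_eqE /= /dvdn. Qed.

Lemma Zmod_intr_eq0 (l : nat) (z : int) : (z%:~R == 0 :> 'Z_(l.+2)) = (l.+2 %| z)%Z.
Proof.
by case: z => j; rewrite ?NegzE ?mulrNz ?oppr_eq0 ?rpredN Zmod_natr_eq0.
Qed.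

(** With [geval_surj], this presents level [i] as [Z[X]/(m, X^n - 1)]. A remainder modulo [X^n - 1]
    has degree below [n], so its monomials go to distinct group elements and its coefficients vanish
    modulo [m]. *)
Lemma geval_ker (P : {poly int}) : geval 1 P = 0 :> ZZmod i ->
  exists B C : {poly int}, P = B * m%:R + C * ('X^n - 1).
Proof.
have n0 : (0 < n)%N by [].
have Xmon : 'X^n - 1 \is @monic int by apply: monic_Xn_sub_1.
rewrite (Pdiv.RingMonic.rdivp_eq Xmon P).
set r := Pdiv.Ring.rmodp _ _; set q := Pdiv.Ring.rdivp _ _.
have sr : (size r <= n)%N.
  by rewrite -ltnS -(size_Xn_sub1_int n0) Pdiv.Ring.ltn_rmodpN0 // monic_neq0.
rewrite gevalD gevalM (_ : geval 1 ('X^n - 1) = 0) ?mulr0 ?add0r; last first.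
  have -> : 'X^n - 1 = 1 *: 'X^n - 1 *: 'X^0 :> {poly int} by rewrite !scale1r expr0.
  rewrite gevalB !gevalZXn.
  rewrite (_ : 1 *+ n = 1 *+ 0) ?subrr //.
  by apply/eqP; rewrite mulr0n -[1 *+ n]/(n%:R) Zmod_natr_eq0.
move=> r0; suff /polyOver_dvdzP[B ->] : r \is a polyOver (dvdz m).
  by exists B, q; rewrite addrC mulr_natr -scaler_nat natz.
apply/polyOverP => j; have [lt_j|le_j] := ltnP j n; last first.
  by rewrite nth_default ?dvdz0 // (leq_trans sr).
rewrite -Zmod_intr_eq0.
have := congr1 (fun x : {malg 'Z_(i.1.+2)['Z_(i.2.+2)]} => x@_(j%:R)) r0.
rewrite mcoeff0 -[r in geval 1 r]coefK poly_def geval_sum.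
rewrite (eq_bigr (fun l : 'I_(size r) =>
  (<< (r`_l)%:~R *g l%:R >> : {malg 'Z_(i.1.+2)['Z_(i.2.+2)]}))); last first.
  by move=> l _; rewrite gevalZXn.
rewrite raddf_sum /=.
have injn (l : nat) : (l < n)%N -> ((l%:R : 'Z_(i.2.+2)) == j%:R) = (l == j).
  by move=> lt_l; rewrite !Zp_nat -val_eqE /= !modn_small.
have [lt_js|le_js] := ltnP j (size r); last by rewrite nth_default.
rewrite (bigD1 (Ordinal lt_js)) //= mcoeffU eqxx mulr1n big1 ?addr0 => [->|l nl]; first exact: eqxx.
rewrite mcoeffU injn ?(leq_trans (ltn_ord l)) //.
by have -> : ((l : nat) == j) = false by apply: negbTE nl.
Qed.

End FiniteLevel.

Lemma grpmap_geval (R S : comNzRingType) (K L : zmodType)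
  (f : {rmorphism R -> S}) (h : {additive K -> L}) (k : K) (P : {poly int}) :
  grpmap f h (geval k P) = geval (h k) P.
Proof.
rewrite /geval -horner_map /= grpmapU rmorph1 -map_poly_comp; congr (_.[_]).
by apply: eq_map_poly => z /=; rewrite rmorph_int.
Qed.

Lemma invproj_sum (I : Type) (le : rel I) (R : I -> comNzRingType)
  (phi : forall i j, le i j -> {rmorphism R j -> R i})
  (J : Type) (r : seq J) (F : J -> invlim phi) i :
  invproj (\sum_(j <- r) F j) i = \sum_(j <- r) invproj (F j) i.
Proof. exact: (big_morph (fun x : invlim phi => invproj x i)). Qed.

Lemma invproj_mulrz (I : Type) (le : rel I) (R : I -> comNzRingType)
  (phi : forall i j, le i j -> {rmorphism R j -> R i})
  (x : invlim phi) (z : int) i : invproj (x *~ z) i = invproj x i *~ z.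
Proof.
have nat_case (n : nat) : invproj (x *+ n) i = invproj x i *+ n.
  by elim: n => [|n IH] //; rewrite !mulrS -IH.
by case: z => n; [exact: nat_case|rewrite NegzE !mulrNz -!pmulrn -nat_case].
Qed.

(** At each level the substitution becomes the ring morphism [grpmap], so it is multiplicative in
    [g]. *)
Lemma invproj_laurent_subst (g : laurent) (mu : Zhat) (i : nat * nat) :
  invproj (laurent_subst g mu) i
  = grpmap (intr : {rmorphism int -> 'Z_(i.1.+2)})
      (intmul (invproj mu i.2) : {additive int -> 'Z_(i.2.+2)}) g.
Proof.
rewrite invproj_sum; apply: eq_bigr => k _.
rewrite invproj_mulrz /= invproj_mulrz.
by rewrite [RHS]grpterm_int mulrzl.
Qed.

(** * Polynomial representatives of Laurent polynomials *)

Lemma poly_Xn_factor (F : {poly int}) : F != 0 ->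
  exists F0 j, F = F0 * 'X^j /\ F0`_0 != 0.
Proof.
move: {2}(size F) (leqnn (size F)) => s; elim: s F => [|s IH] F sF nzF.
  by move: sF; rewrite leqn0 size_poly_eq0 (negPf nzF).
elim/poly_ind: F sF nzF => [|p c _] sF nzF; first by rewrite eqxx in nzF.
have [c0|nzc] := eqVneq c 0; last first.
  by exists (p * 'X + c%:P), 0%N; rewrite expr0 mulr1 coefD coefMX coefC add0r.
rewrite c0 addr0 in sF nzF *.
have nzp : p != 0 by apply: contraNneq nzF => ->; rewrite mul0r.
have [|F0 [j [-> F00]]] := IH p _ nzp; first by rewrite size_mulX in sF.
by exists F0, j.+1; rewrite exprSr mulrA.
Qed.

Lemma laurent_rep (f : laurent) : exists (F : {poly int}) (k : int),
  f = geval 1 F * grpterm 1 k /\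
  forall a, laurent_root f a -> root (ZtoC F) a.
Proof.
(* A shift large enough to make all exponents of [f] nonnegative. *)
pose k0 := \sum_(k <- msupp f) `|k|.
have k0P k : k \in msupp f -> 0 <= k + k0.
  move=> kf; rewrite /k0 (big_rem k kf) /= addrA addr_ge0 //.
    by rewrite -[k in k + _]opprK addrC subr_ge0 -normrN ler_norm.
  by apply: sumr_ge0.
pose F : {poly int} := \sum_(k <- msupp f) f@_k *: 'X^`|(k + k0)%R|%N.
exists F, (- k0); split.
  rewrite geval_sum mulr_suml [LHS]grpringE !big_seq; apply: eq_bigr => k kf.
  rewrite gevalZXn intz grptermM mulr1; congr grpterm.
  by rewrite -[1 *+ _]/(_%:R) natz gez0_abs ?k0P // addrK.
move=> a [nza fa]; rewrite /root.
suff -> : (ZtoC F).[a] = laurent_eval f a * a ^ k0 by rewrite fa mul0r.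
rewrite rmorph_sum horner_sum mulr_suml !big_seq; apply: eq_bigr => k kf.
rewrite -mul_polyC rmorphM /= map_polyC map_polyXn !hornerE /=.
by rewrite -mulrA -expfzDr // -[in RHS](gez0_abs (k0P k kf)) -exprnP.
Qed.

(** The nonzero constant term is the condition under which [dvdp_of_in_ideal] applies. *)
Lemma laurent_rep_neq0 (f : laurent) : f != 0 ->
  exists (F : {poly int}) (k : int), [/\ f = geval 1 F * grpterm 1 k, F`_0 != 0 &
  forall a, laurent_root f a -> root (ZtoC F) a].
Proof.
move=> nzf; have [F [k [Df rF]]] := laurent_rep f.
have [|F0 [j [DF F00]]] := @poly_Xn_factor F.
  by apply: contraNneq nzf => F0; rewrite Df F0 geval0 mul0r.
exists F0, (j%:R + k); split; [|exact: F00|].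
  rewrite Df DF gevalM -mulrA; congr (_ * _).
  by rewrite -['X^j]scale1r gevalZXn grptermM mulr1.
move=> a fa; have := rF a fa; rewrite DF rmorphM rootM => /orP[//|].
have [nza _] := fa.
by rewrite /root /= map_polyXn hornerXn expf_eq0 (negPf nza) andbF.
Qed.

(** The natural number representing [mu] modulo [n], meaningful for [n >= 2]: the component of index
    [n - 2] has modulus [n]. *)
Definition residue (mu : Zhat) (n : nat) : nat := (invproj mu n.-2 : 'Z_(n.-2.+2)).

Lemma residue1 n : residue 1 n = 1%N.
Proof. by []. Qed.

Lemma residueE (mu : Zhat) n : (residue mu n.+2)%:R = invproj mu n.
Proof. exact: natr_Zp. Qed.

Lemma residue_compat (mu : Zhat) N n : (1 < N)%N -> (1 < n)%N -> (N %| n)%N ->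
  residue mu n = residue mu N %[mod N].
Proof.
case: N n => [|[|N]] [|[|n]] // _ _ Nn.
have E : (residue mu n.+2 %% N.+2)%N = residue mu N.+2 := congr1 val (invprojP mu (Nn : dvd2 N n)).
by rewrite -[in RHS]E modn_mod.
Qed.

Lemma residueM (mu nu : Zhat) n : (1 < n)%N -> mu * nu = 1 ->
  residue mu n * residue nu n = 1 %[mod n].
Proof.
case: n => [|[|n]] // _ E.
have E1 : (residue mu n.+2 * residue nu n.+2 %% n.+2)%N = 1%N.
  exact: (congr1 (fun x : Zhat => val (invproj x n)) E).
by rewrite -[in RHS]E1 modn_mod.
Qed.

(** Carries membership in a principal ideal to every finite level, where the monomials relating [f]
    to [F] and [g] to [G] are units. *)
Lemma in_ideal_of_principal (f g : laurent) (F G : {poly int}) (k l : int) (mu nu : Zhat) :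
  f = geval 1 F * grpterm 1 k -> g = geval 1 G * grpterm 1 l ->
  principal_ideal (laurent_subst f nu) (laurent_subst g mu) ->
  forall m n, (1 < m)%N -> (1 < n)%N ->
    in_ideal (F \Po 'X^(residue nu n)) m n (G \Po 'X^(residue mu n)).
Proof.
move=> Df Dg [r Er] [|[|m]] [|[|n]] // _ _; pose i := (m, n).
have lev (h : laurent) (H : {poly int}) (j : int) (xi : Zhat) : h = geval 1 H * grpterm 1 j ->
    geval 1 (H \Po 'X^(residue xi n.+2))
    = invproj (laurent_subst h xi) i * grpterm 1 (invproj xi n *~ (- j)) :> ZZmod i.
  move=> ->; rewrite invproj_laurent_subst rmorphM /= grpmap_geval grpmapU rmorph1 /=.
  rewrite -mulrA grpterm_mulrzK mulr1.
  by rewrite geval_comp_Xn /= -[1 *+ _]/(_%:R) residueE mulr1z.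
have Eg := lev g G l mu Dg; have Ef := lev f F k nu Df.
(* [A] lifts the multiplier [r], corrected by these monomials. *)
have [A DA] := geval_surj (invproj r i * grpterm 1 (invproj mu n *~ (- l))
   * grpterm 1 (invproj nu n *~ k) : ZZmod i).
have [|B [C DBC]] := @geval_ker i (G \Po 'X^(residue mu n.+2) - A * (F \Po 'X^(residue nu n.+2))).
  rewrite gevalB gevalM Eg Ef -DA Er /=.
  have cancel (R : comNzRingType) (x y u v w : R) :
      v * w = 1 -> x * y * u - x * u * v * (y * w) = 0.
    move=> vw; have -> : x * u * v * (y * w) = x * y * u * (v * w) by ring.
    by rewrite vw mulr1 subrr.
  exact: cancel (grpterm_mulrzK _ _ _).
exists A, B, C; rewrite -addrA -DBC /=; ring.
Qed.

Lemma in_ideal_zero_eq0 (H : {poly int}) :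
  (forall m n, (1 < m)%N -> (1 < n)%N -> in_ideal 0 m n H) -> H = 0.
Proof.
move=> IH; apply: (@poly_eq0_of_dvdn _ 2) => // i.
have m1 : (1 < 2 ^ i.+1)%N by rewrite -[1%N](expn0 2) ltn_exp2l.
have [|K ->] := in_ideal_contents _ m1 (fun n => IH _ n m1).
  by exists 0; rewrite mul0r.
by exists (K * 2%:R); rewrite expnSr natrM; ring.
Qed.

Lemma in_ideal_comp (F H : {poly int}) m n k :
  in_ideal F m n H -> in_ideal (F \Po 'X^k) m n (H \Po 'X^k).
Proof.
move=> [A [B [C ->]]]; have [D DX] := Xn_sub1_dvd_XnM n k.
exists (A \Po 'X^k), (B \Po 'X^k), ((C \Po 'X^k) * D).
rewrite !comp_polyD !comp_polyM rmorph_nat comp_polyB comp_Xn_poly comp_polyC.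
by rewrite -exprM mulnC DX mulrA.
Qed.

(** Modulo [X^n - 1], substituting [X^k'] undoes the substitution of [X^k]. *)
Lemma in_ideal_comp_inv (F H : {poly int}) m n k k' : (k * k' = 1 %[mod n])%N ->
  in_ideal F m n (H \Po 'X^k) -> in_ideal (F \Po 'X^k') m n H.
Proof.
move=> kk' /(in_ideal_comp k'); rewrite -comp_polyA comp_Xn_poly -exprM mulnC => IH.
have : in_ideal (F \Po 'X^k') m n (H \Po 'X^1).
  exact: in_ideal_subr (in_ideal_comp_mod _ _ _ (esym kk')) IH.
by rewrite expr1 comp_polyXr.
Qed.

Lemma in_ideal_swap (F G : {poly int}) m n k k' : (k * k' = 1 %[mod n])%N ->
  in_ideal (G \Po 'X^k) m n F -> in_ideal G m n (F \Po 'X^k').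
Proof.
move=> kk' /(in_ideal_comp k'); rewrite -comp_polyA comp_Xn_poly -exprM mulnC.
move=> [A [B [C ->]]]; apply: in_idealD; first apply: in_idealD.
- apply/in_idealM/(@in_ideal_subr _ _ _ _ (G \Po 'X^1)).
    exact: in_ideal_comp_mod.
  by rewrite expr1 comp_polyXr; exists 1, 0, 0; rewrite mul1r !mul0r !addr0.
- by exists 0, B, 0; rewrite !mul0r add0r addr0.
exact: in_ideal_Xn1.
Qed.

Lemma laurent_subst0 (mu : Zhat) : laurent_subst 0 mu = 0.
Proof. by rewrite /laurent_subst msupp0 big_seq_fset0. Qed.

(** At each level the inverse of [mu] undoes the substitution, and only 0 lies in all the ideals
    [(m, X^n - 1)]. *)
Lemma laurent_eq0_of_principal (f : laurent) (mu : Zhat) : is_unit mu ->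
  principal_ideal 0 (laurent_subst f mu) -> f = 0.
Proof.
move=> [nu munu]; rewrite -(laurent_subst0 1) => If.
have [F [k [Df _]]] := laurent_rep f.
have D0 : (0 : laurent) = geval 1 0 * grpterm 1 0 by rewrite geval0 mul0r.
have IF := in_ideal_of_principal D0 Df If.
suff F0 : F = 0 by rewrite Df F0 geval0 mul0r.
apply: in_ideal_zero_eq0 => m n m1 n1.
by have := in_ideal_comp_inv (residueM n1 munu) (IF m n m1 n1); rewrite !comp_poly0.
Qed.

(** Because [mu] is invertible, [c] and [b] divide each other, so [b = c]; then [c] is cancelled at
    the moduli [c * N]. *)
Lemma Zhat_ratio_pm1 (mu nu : Zhat) : mu * nu = 1 ->
  (exists c b s, (0 < c)%N /\ forall N, (1 < N)%N -> congr_pm s N (c * residue mu N) b) ->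
  mu = 1 \/ mu = -1.
Proof.
move=> munu [c [b [s [c0 H]]]].
have unit N (N1 : (1 < N)%N) := residueM N1 munu.
have b0 : (0 < b)%N.
  (* If [b = 0], then [mu] invertible modulo [c + 1] forces [c + 1] to divide [c]. *)
  rewrite lt0n; apply/eqP => b0; have c1 : (1 < c.+1)%N by rewrite ltnS.
  have : (c * residue mu c.+1 = 0 %[mod c.+1])%N.
    by have := H _ c1; rewrite /congr_pm b0 addn0; case: s {H} => /eqP.
  move=> /(congr1 (fun x => x * residue nu c.+1 %% c.+1))%N.
  rewrite !modnMml -mulnA -modnMmr (unit _ c1) modnMmr muln1 mul0n mod0n.
  by rewrite modn_small ?ltnSn // => cc; rewrite cc in c0.
(* The factor 2 keeps the moduli above 1 when [c] or [b] is 1. *)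
have c1 : (1 < c * 2)%N by clear -c0; lia.
have b1 : (1 < b * 2)%N by clear -b0; lia.
have cb : (c %| b)%N.
  have := H _ c1; rewrite /congr_pm; case: s {H} => /eqP/(congr1 (fun x => x %% c)%N).
    by rewrite !modn_dvdm ?dvdn_mulr // modnMr => /esym/eqP.
  by rewrite !modn_dvdm ?dvdn_mulr // -modnDml modnMr add0n mod0n => /eqP.
have bc : (b %| c)%N.
  have b2 : (b %| b * 2)%N := dvdn_mulr 2 (dvdnn b).
  have bcm : (b %| c * residue mu (b * 2))%N.
    have := H _ b1; rewrite /congr_pm; case: s {H cb} => /eqP/(congr1 (fun x => x %% b)%N).
      by rewrite !(modn_dvdm _ b2) modnn => /eqP.
    by rewrite !(modn_dvdm _ b2) -modnDmr modnn addn0 mod0n => /eqP.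
  have := dvdn_mulr (residue nu (b * 2)) bcm.
  rewrite -mulnA /dvdn -modnMmr.
  rewrite -(modn_dvdm (residue mu (b * 2) * _) b2) (unit _ b1).
  by rewrite (modn_dvdm _ b2) modnMmr muln1.
have Ebc : b = c by apply/eqP; rewrite eqn_dvd bc.
have H1 N : (1 < N)%N -> congr_pm s N (residue mu N) 1.
  move=> N1; have cN1 : (1 < c * N)%N by clear -c0 N1; nia.
  have := H _ cN1; rewrite Ebc /congr_pm; case: s {H} => [|].
    rewrite -[X in _ == X %[mod _]]muln1 -!muln_modr eqn_pmul2l // => /eqP E.
    by rewrite -(residue_compat mu N1 cN1) ?dvdn_mull //; apply/eqP.
  rewrite -[X in _ + X == _ %[mod _]]muln1 -mulnDr mod0n -muln_modr muln_eq0.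
  rewrite (gtn_eqF c0) /= => /eqP E.
  by rewrite -modnDml -(residue_compat mu N1 cN1) ?dvdn_mull // modnDml E mod0n.
case: s H H1 => _ H1; [left|right]; apply: invlimP => n.
  have := H1 n.+2 isT; rewrite /congr_pm /residue /= => /eqP E.
  by apply: val_inj; rewrite /= -E modn_small //; apply: ltn_ord.
have := H1 n.+2 isT; rewrite /congr_pm addn1 => E.
apply/eqP; rewrite -[invproj (-1) n]/(-1) -addr_eq0 -residueE natr1.
by rewrite Zmod_natr_eq0 /dvdn (eqP E) mod0n.
Qed.

Lemma laurent_subst_opp1 (g : laurent) :
  laurent_subst g (-1) = laurent_embed (laurent_inv g).
Proof.
apply: invlimP => i; rewrite !invproj_laurent_subst /laurent_inv raddf_sum.
apply: eq_bigr => k _; rewrite /= grpmapU; congr grpterm.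
exact: etrans (mulNrz _ _) (esym (mulrNz _ _)).
Qed.

(** The polynomial representatives agree up to sign, so the unit is plus or minus a power of [t]. *)
Lemma eq_up_to_unit_of_ideals (f g : laurent) : f != 0 -> g != 0 ->
  principal_ideal (laurent_embed f) = principal_ideal (laurent_embed g) ->
  eq_up_to_unit f g.
Proof.
move=> nzf nzg E.
have [F [k [Df F0 _]]] := laurent_rep_neq0 nzf.
have [G [l [Dg G0 _]]] := laurent_rep_neq0 nzg.
have X1 (H : {poly int}) : H \Po 'X^1 = H by rewrite expr1 comp_polyXr.
have IG : forall m n, (1 < m)%N -> (1 < n)%N -> in_ideal F m n G.
  move=> m n m1 n1; rewrite -[F]X1 -[G]X1 -(residue1 n).
  apply: in_ideal_of_principal Df Dg _ _ _ m1 n1.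
  by rewrite -/(laurent_embed f) E; exists 1; rewrite mul1r.
have IF : forall m n, (1 < m)%N -> (1 < n)%N -> in_ideal G m n F.
  move=> m n m1 n1; rewrite -[F]X1 -[G]X1 -(residue1 n).
  apply: in_ideal_of_principal Dg Df _ _ _ m1 n1.
  by rewrite -/(laurent_embed g) -E; exists 1; rewrite mul1r.
have uU (e : int) (j : int) : e * e = 1 -> is_unit (grpterm e j : laurent).
  by move=> ee; exists (grpterm e (- j)); rewrite grptermM ee subrr grpterm1.
have D e : e%:P * G = F -> f = grpterm e (k - l) * g.
  have De : e%:~R = grpterm e 0 :> laurent by rewrite -{2}[e]intz grpterm_int grpterm1 mulr1.
  move=> DF; rewrite Df Dg -DF gevalM {1}/geval map_polyC hornerC /= De.
  rewrite -mulrA mulrCA [RHS]mulrCA; congr (_ * _).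
  by rewrite !grptermM !mulr1 add0r subrK.
have [DF|DF] := in_ideal_antisym F0 G0 IG IF.
  by exists (grpterm 1 (k - l)); [apply: uU|apply: D; rewrite mul1r].
exists (grpterm (-1) (k - l)); first exact: uU.
by apply: D; rewrite DF rmorphN mulN1r.
Qed.

Theorem corollary1p5 (f g : laurent) (mu : Zhat)
  (fg_neq0 : ~ (f = 0 /\ g = 0))
  (mu_unit : is_unit mu)
  (eq_ideals :
     principal_ideal (laurent_embed f) = principal_ideal (laurent_subst g mu))
  (root_fg : exists a : algC,
     (laurent_root f a \/ laurent_root g a) /\ ~ is_root_of_unity a) :
  (mu = 1 /\ eq_up_to_unit f g) \/ (mu = -1 /\ eq_up_to_unit f (laurent_inv g)).
Proof.
have [nu munu] := mu_unit.
have [F [k [Df rF]]] := laurent_rep f; have [G [l [Dg rG]]] := laurent_rep g.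
have X1 (H : {poly int}) : H \Po 'X^1 = H by rewrite expr1 comp_polyXr.
have IG : forall m n, (1 < m)%N -> (1 < n)%N -> in_ideal F m n (G \Po 'X^(residue mu n)).
  move=> m n m1 n1; rewrite -[F]X1 -(residue1 n).
  apply: in_ideal_of_principal Df Dg _ _ _ m1 n1.
  by rewrite -/(laurent_embed f) eq_ideals; exists 1; rewrite mul1r.
have IF : forall m n, (1 < m)%N -> (1 < n)%N -> in_ideal (G \Po 'X^(residue mu n)) m n F.
  move=> m n m1 n1; rewrite -[X in in_ideal _ _ _ X]X1 -(residue1 n).
  apply: in_ideal_of_principal Dg Df _ _ _ m1 n1.
  by rewrite -/(laurent_embed f) -eq_ideals; exists 1; rewrite mul1r.
have IF' : forall m n, (1 < m)%N -> (1 < n)%N -> in_ideal G m n (F \Po 'X^(residue nu n)).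
  by move=> m n m1 n1; apply: in_ideal_swap (residueM n1 munu) (IF m n m1 n1).
have in_principal (x : ZhatZhat) : principal_ideal x x by exists 1; rewrite mul1r.
have unit1 : is_unit (1 : Zhat) by exists 1; rewrite mulr1.
(* If [f = 0], then [g(t^mu)] lies in the zero ideal, so [g = 0], against [fg_neq0]. *)
have nzf : f != 0.
  apply/eqP => f0; apply: fg_neq0; split=> //; apply: laurent_eq0_of_principal mu_unit _.
  by rewrite -(laurent_subst0 1) -f0 -/(laurent_embed f) eq_ideals.
(* Stated for any [h] because it also serves for [laurent_inv g]. *)
have nzg (h : laurent) nu' :
    principal_ideal (laurent_embed f) = principal_ideal (laurent_subst h nu') -> h != 0.
  move=> E; apply: contraNneq nzf => h0; apply/eqP; apply: laurent_eq0_of_principal unit1 _.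
  by rewrite -(laurent_subst0 nu') -h0 -E.
have nzF : F != 0 by apply: contraNneq nzf => F0; rewrite Df F0 geval0 mul0r.
have nzG : G != 0 by apply: contraNneq (nzg _ _ eq_ideals) => G0; rewrite Dg G0 geval0 mul0r.
have nu_mu : nu * mu = 1 by rewrite mulrC.
have mu_pm1 : mu = 1 \/ mu = -1.
  have [a [fga nua]] := root_fg.
  have {}nua : forall n, (0 < n)%N -> a ^+ n != 1.
    by move=> n n0; apply/negP => an; apply: nua; exists n; rewrite ?unity_rootE.
  case: fga => [fa|ga].
    apply: Zhat_ratio_pm1 munu _.
    exact: exists_integer_ratio nzG (rF a fa) (proj1 fa) nua IG (residue_compat mu).
  have : nu = 1 \/ nu = -1.
    apply: Zhat_ratio_pm1 nu_mu _.
    exact: exists_integer_ratio nzF (rG a ga) (proj1 ga) nua IF' (residue_compat nu).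
  case=> E; [left|right]; first by rewrite -munu E mulr1.
  by rewrite -munu E mulrN1 opprK.
case: mu_pm1 => E; rewrite E ?laurent_subst_opp1 in eq_ideals; [left|right]; split=> //.
  exact: eq_up_to_unit_of_ideals nzf (nzg _ _ eq_ideals) eq_ideals.
exact: eq_up_to_unit_of_ideals nzf (nzg _ _ eq_ideals) eq_ideals.
Qed.
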